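(* For all $m\in\mathbb Z$ we have $t_1\star\psi_m=t_1\star\varphi_m=0$.
   Context: $\tilde W=\langle s_0,s_1\mid s_0^2=s_1^2=1\rangle$ is the affine Weyl group of $\mathrm{SL}_2$ (the infinite dihedral group), with length function $\ell$, strong Bruhat order $\le$ and identity $1$. With $q^{1/2}$ first viewed as an indeterminate, let $\mathcal A=\mathbb Z[q^{1/2},q^{-1/2}]$. $H$ is the $\mathcal A$-algebra with $\mathcal A$-basis $\{T_w\}_{w\in\tilde W}$ and relations $T_wT_{w'}=T_{ww'}$ if $\ell(ww')=\ell(w)+\ell(w')$, and $(T_s+1)(T_s-q)=0$ for $s\in\{s_0,s_1\}$. The Kazhdan–Lusztig bases (all Kazhdan–Lusztig polynomials equal $1$ here) are $$C_w=\sum_{y\le w}(-1)^{\ell(w)-\ell(y)}q^{\frac{\ell(w)-\ell(y)}{2}}q^{-\frac{\ell(y)}{2}}T_y,\qquad C'_w=q^{-\frac{\ell(w)}{2}}\sum_{y\le w}T_y.$$ Let $\overline{(\,\cdot\,)}$ be the involution of $\mathcal A$ with $\overline{q^{1/2}}=q^{-1/2}$, and let $j$ be the ring involution $j(\sum a_wT_w)=\sum\overline{a_w}(-1)^{\ell(w)}q^{-\ell(w)}T_w$ of $H$; then $C'_w=(-1)^{\ell(w)}j(C_w)$. Define $h_{x,y,z}\in\mathcal A$ by $C_xC_y=\sum_z h_{x,y,z}C_z$. The set of distinguished involutions is $\mathcal D=\{1,s_0,s_1\}$, and Lusztig's $a$-function has values $a(1)=0$, $a(w)=1$ for $w\ne1$.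 $J$ is Lusztig's asymptotic Hecke algebra, with $\mathbb Z$-basis $\{t_w\}_{w\in\tilde W}$, and the $\mathcal A$-algebra map $\phi\colon H\to J\otimes_{\mathbb Z}\mathcal A$ is $\phi(C_x)=\sum_{z\in\tilde W,\,d\in\mathcal D,\,a(d)=a(z)}h_{x,d,z}t_z$. Completions: $\mathcal H$ is the set of formal sums $\sum b_xC_x$ with $b_x\in\mathbb Z((q^{1/2}))$ such that for every $N>0$, $b_x\in q^{N/2}\mathbb Z[[q^{1/2}]]$ for $\ell(x)$ large; $\mathcal J$ is the same with $t_x$ in place of $C_x$. $\phi$ extends coefficientwise to an isomorphism $\mathcal H\to\mathcal J$. $\mathcal H'$ is the set of formal sums $\sum b_xC'_x$ with $b_x\in\mathbb Z((q^{-1/2}))$ satisfying the same condition with $q^{-1/2}$ in place of $q^{1/2}$, and $j$ gives mutually inverse bijections between $\mathcal H'$ and $\mathcal H$, $j(\sum b_xC'_x)=\sum(-1)^{\ell(x)}\overline{b_x}C_x$. Expanding each $C'_x$, one writes $(\phi\circ j)^{-1}(t_w)=j(\phi^{-1}(t_w))\in\mathcal H'$ as $\sum_x b_{w,x}T_x$; the $b_{w,x}$ are rational functions of $q^{1/2}$ with denominators of the form $q^{m/2}(q+1)$. Now let $F$ be a non-archimedean local field with ring of integers $\mathcal O$, uniformizer $\pi$, and let $q$ be the cardinality of $\mathcal O/\pi\mathcal O$. Let $G=\mathrm{SL}_2(F)$, $K=\mathrm{SL}_2(\mathcal O)$, and let $I\subset K$ be the Iwahori subgroup of matrices that are upper triangular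 modulo $\pi$. Elements of $\tilde W$ are lifted to $G$ via $s_0\mapsto\begin{pmatrix}0&-1\\1&0\end{pmatrix}$, $s_1\mapsto\begin{pmatrix}0&\pi^{-1}\\-\pi&0\end{pmatrix}$, and $T_x$ is identified with the characteristic function of $IxI$. From here on, $t_w$ denotes the function $\sum_x b_{w,x}T_x$ on $G$, with $q$ specialized to its numerical value. On $F^2\setminus\{0\}$ (column vectors), let $\psi_n$ be the characteristic function of the $I$-orbit $\begin{pmatrix}\pi^n\mathcal O^\times\\ \pi^{n+1}\mathcal O\end{pmatrix}$ and $\varphi_n$ that of the $I$-orbit $\begin{pmatrix}\pi^n\mathcal O\\ \pi^n\mathcal O^\times\end{pmatrix}$, $n\in\mathbb Z$. Convolution is $(f\star h)(x)=\int_Gf(u)h(u^{-1}x)\,du$ for $x\in F^2\setminus\{0\}$, with Haar measure normalized by $\mathrm{vol}(I)=1$ (so $f\star h$ is the sum over cosets $uI\in G/I$). *)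

(* Defs.v *)
From HB Require Import structures.
From mathcomp Require Import all_boot all_order all_algebra.
From mathcomp Require Import all_classical all_reals all_analysis.
From mathcomp Require Import zify.

Set Implicit Arguments.
Unset Strict Implicit.
Unset Printing Implicit Defensive.

Import Order.TTheory GRing.Theory Num.Theory.
Local Open Scope classical_set_scope.
Local Open Scope ring_scope.

Definition vanish_below (f : int -> int) (a : nat) :=
  forall n : int, n < - a%:Z -> f n = 0.

Definition bounded_below : {pred int -> int} :=
  fun f => `[< exists a, vanish_below f a >].

Lemma bounded_belowP f :
  reflect (exists a, vanish_below f a) (f \in bounded_below).
Proof. exact: asboolP. Qed.

Lemma vanish_below_addl f a b : vanish_below f a -> vanish_below f (b + a).
Proof.
move=> fa n nab; apply: fa; apply: lt_le_trans nab _.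
by rewrite PoszD opprD gerDr oppr_le0.
Qed.

Lemma vanish_below_addr f a b : vanish_below f a -> vanish_below f (a + b).
Proof. by rewrite addnC; exact: vanish_below_addl. Qed.

Lemma bounded_below_zmod : zmod_closed bounded_below.
Proof.
split; first by apply/bounded_belowP; exists 0%N.
move=> f g /bounded_belowP[a fa] /bounded_belowP[b gb].
apply/bounded_belowP; exists (a + b)%N => n nab.
by rewrite !fctE (vanish_below_addr fa nab) (vanish_below_addl gb nab) subr0.
Qed.

HB.instance Definition _ :=
  GRing.isZmodClosed.Build (int -> int) bounded_below bounded_below_zmod.

(* The ring Z((t)) of Laurent series; lcoef f n is the coefficient of t^n.
   The variable t is not part of the type: it stands for q^{1/2} in the
   coefficients of the completion in the basis C, and for q^{-1/2} in the
   coefficients of the completion in the basis C'. *)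
Record laurent := Laurent {
  lcoef :> int -> int;
  lcoefP : lcoef \in bounded_below }.

HB.instance Definition _ := [isSub for lcoef].
HB.instance Definition _ := [Choice of laurent by <:].
HB.instance Definition _ := [SubChoice_isSubZmodule of laurent by <:].

Definition cauchy_prod (f g : int -> int) (n : int) : int :=
  \sum_(i \in [set: int]) f i * g (n - i).

Lemma int_above (a : nat) (n : int) : - a%:Z <= n ->
  exists k : nat, n = k%:Z - a%:Z.
Proof. by move=> an; exists (absz (n + a%:Z)); lia. Qed.

Lemma fsum_seq (F : int -> int) (s : seq int) : uniq s ->
  (forall i, i \notin s -> F i = 0) ->
  \sum_(i \in [set: int]) F i = \sum_(i <- s) F i.
Proof.
move=> us F0; rewrite (fsbig_seq _ _ us) -(fsbig_widen [set` s] setT)//.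
by move=> i [_ /negP /F0].
Qed.

Lemma cauchy_prodE f g a b (k : nat) : vanish_below f a -> vanish_below g b ->
  cauchy_prod f g (k%:Z - (a + b)%N%:Z) =
  \sum_(i < k.+1) f (i%:Z - a%:Z) * g ((k - i)%N%:Z - b%:Z).
Proof.
move=> fa gb; rewrite /cauchy_prod.
pose s := [seq (i%:Z - a%:Z) | i <- index_iota 0 k.+1].
have us : uniq s.
  by rewrite map_inj_uniq ?iota_uniq// => i j /addIr[].
rewrite (fsum_seq us); last first.
  move=> i si.
  have [ia|ia] := ltP i (- a%:Z); first by rewrite fa// mul0r.
  rewrite gb ?mulr0//.
  have [m im] := int_above ia.
  have km : (k < m)%N.
    rewrite ltnNge; apply: contra si => mk; apply/mapP; exists m => //.
    by rewrite mem_index_iota/= ltnS.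
  by rewrite im PoszD; lia.
rewrite big_map big_mkord; apply: eq_bigr => i _; congr (_ * g _).
have ik : (i <= k)%N by rewrite -ltnS.
by rewrite -subzn// PoszD; lia.
Qed.

Definition trunc_poly (f : int -> int) (a M : nat) : {poly int} :=
  \poly_(i < M) f (i%:Z - a%:Z).

Lemma cauchy_prod_poly f g a b k M : vanish_below f a -> vanish_below g b ->
  (k < M)%N ->
  cauchy_prod f g (k%:Z - (a + b)%N%:Z) =
  (trunc_poly f a M * trunc_poly g b M)`_k.
Proof.
move=> fa gb kM; rewrite (cauchy_prodE _ fa gb) coefM.
apply: eq_bigr => i _; rewrite !coef_poly.
have ik : (i <= k)%N by rewrite -ltnS.
by rewrite (leq_ltn_trans ik kM) (leq_ltn_trans (leq_subr _ _) kM).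
Qed.

Lemma vanish_cauchy_prod f g a b : vanish_below f a -> vanish_below g b ->
  vanish_below (cauchy_prod f g) (a + b).
Proof.
move=> fa gb n nab; apply: fsbig1 => i _.
have [ia|ia] := ltP i (- a%:Z); first by rewrite fa// mul0r.
by rewrite gb ?mulr0//; move: nab ia; rewrite PoszD; lia.
Qed.

Lemma vanish_ext f g a : vanish_below f a -> vanish_below g a ->
  (forall k : nat, f (k%:Z - a%:Z) = g (k%:Z - a%:Z)) -> f = g.
Proof.
move=> fa ga fg; apply/funext => n.
have [na|/int_above[k ->]//] := ltP n (- a%:Z).
by rewrite fa// ga.
Qed.

Lemma trunc_cauchy_prod f g a b k M : vanish_below f a -> vanish_below g b ->
  (k < M)%N ->
  (trunc_poly (cauchy_prod f g) (a + b) M)`_k =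
  (trunc_poly f a M * trunc_poly g b M)`_k.
Proof.
by move=> fa gb kM; rewrite coef_poly kM (cauchy_prod_poly fa gb kM).
Qed.

Lemma cauchy_prodA f g h a b c : vanish_below f a -> vanish_below g b ->
  vanish_below h c ->
  cauchy_prod f (cauchy_prod g h) = cauchy_prod (cauchy_prod f g) h.
Proof.
move=> fa gb hc; apply: (@vanish_ext _ _ (a + (b + c))%N).
- by do 2?apply: vanish_cauchy_prod.
- by rewrite addnA; do 2?apply: vanish_cauchy_prod.
move=> k.
rewrite (cauchy_prod_poly fa (vanish_cauchy_prod gb hc) (ltnSn k)).
rewrite addnA (cauchy_prod_poly (vanish_cauchy_prod fa gb) hc (ltnSn k)).
transitivity ((trunc_poly f a k.+1 *
  (trunc_poly g b k.+1 * trunc_poly h c k.+1))`_k).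
  rewrite coefM [RHS]coefM; apply: eq_bigr => i _; congr (_ * _).
  by rewrite trunc_cauchy_prod// ltnS leq_subr.
rewrite mulrA coefM [RHS]coefM; apply: eq_bigr => i _; congr (_ * _).
by rewrite trunc_cauchy_prod// ltn_ord.
Qed.

Lemma cauchy_prodC f g a b : vanish_below f a -> vanish_below g b ->
  cauchy_prod f g = cauchy_prod g f.
Proof.
move=> fa gb; apply: (@vanish_ext _ _ (a + b)%N).
- exact: vanish_cauchy_prod.
- by rewrite addnC; exact: vanish_cauchy_prod.
move=> k; rewrite (cauchy_prod_poly fa gb (ltnSn k)) mulrC.
by rewrite addnC (cauchy_prod_poly gb fa (ltnSn k)).
Qed.

Definition mono (k : int) : int -> int := fun n => (n == k)%:R.

Lemma mono_subproof k : mono k \in bounded_below.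
Proof.
apply/bounded_belowP; exists `|k|%N => n nk; rewrite /mono.
by case: eqP => // nk'; move: nk; rewrite nk'; lia.
Qed.

Lemma cauchy_prod1 f a : vanish_below f a -> cauchy_prod (mono 0) f = f.
Proof.
move=> fa; apply/funext => n; rewrite /cauchy_prod.
rewrite (@fsum_seq _ [:: 0])//; last first.
  by move=> i; rewrite inE /mono => /negbTE->; rewrite mul0r.
by rewrite big_seq1 /mono eqxx mul1r subr0.
Qed.

Lemma cauchy_prodDl f g h a b c : vanish_below f a -> vanish_below g b ->
  vanish_below h c ->
  cauchy_prod (f \+ g) h = cauchy_prod f h \+ cauchy_prod g h.
Proof.
move=> /(@vanish_below_addr _ _ b) fa /(@vanish_below_addl _ _ a) gb hc.
have fg : vanish_below (f \+ g) (a + b).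
  by move=> n nab /=; rewrite fa// gb// addr0.
apply: (@vanish_ext _ _ (a + b + c)%N).
- exact: vanish_cauchy_prod.
- move=> n nabc /=.
  by rewrite (vanish_cauchy_prod fa hc nabc) (vanish_cauchy_prod gb hc nabc).
move=> k /=; rewrite !(cauchy_prodE _ _ hc)// -big_split/=.
by apply: eq_bigr => i _; rewrite mulrDl.
Qed.

Lemma laurent_mul_subproof (f g : laurent) :
  cauchy_prod f g \in bounded_below.
Proof.
have /bounded_belowP[a fa] := lcoefP f; have /bounded_belowP[b gb] := lcoefP g.
by apply/bounded_belowP; exists (a + b)%N; exact: vanish_cauchy_prod.
Qed.

Definition laurent_mul (f g : laurent) := Laurent (laurent_mul_subproof f g).
Definition laurent_mono (k : int) := Laurent (mono_subproof k).

Lemma laurent_mulA : associative laurent_mul.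
Proof.
move=> f g h; apply: val_inj => /=.
have /bounded_belowP[a fa] := lcoefP f; have /bounded_belowP[b gb] := lcoefP g.
have /bounded_belowP[c hc] := lcoefP h; exact: cauchy_prodA fa gb hc.
Qed.

Lemma laurent_mulC : commutative laurent_mul.
Proof.
move=> f g; apply: val_inj => /=.
have /bounded_belowP[a fa] := lcoefP f; have /bounded_belowP[b gb] := lcoefP g.
exact: cauchy_prodC fa gb.
Qed.

Lemma laurent_mul1 : left_id (laurent_mono 0) laurent_mul.
Proof.
move=> f; apply: val_inj => /=.
by have /bounded_belowP[a fa] := lcoefP f; exact: cauchy_prod1 fa.
Qed.

Lemma laurent_mulDl : left_distributive laurent_mul +%R.
Proof.
move=> f g h; apply: val_inj => /=.
have /bounded_belowP[a fa] := lcoefP f; have /bounded_belowP[b gb] := lcoefP g.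
have /bounded_belowP[c hc] := lcoefP h; exact: cauchy_prodDl fa gb hc.
Qed.

Lemma laurent_oner_neq0 : laurent_mono 0 != 0.
Proof. by apply/eqP => /(congr1 (fun f : laurent => f 0)). Qed.

HB.instance Definition _ := GRing.Zmodule_isComNzRing.Build laurent
  laurent_mulA laurent_mulC laurent_mul1 laurent_mulDl laurent_oner_neq0.

Definition vanish_above (f : int -> int) (d : nat) :=
  forall n : int, d%:Z < n -> f n = 0.

Definition laurent_polynomial : {pred laurent} :=
  fun f => `[< exists d, vanish_above f d >].

Lemma laurent_polynomialP (f : laurent) :
  reflect (exists d, vanish_above f d) (f \in laurent_polynomial).
Proof. exact: asboolP. Qed.

Lemma laurent_polynomial_subring : subring_closed laurent_polynomial.
Proof.
split.
- apply/laurent_polynomialP; exists 0%N => n n0 /=.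
  by rewrite /mono gt_eqF.
- move=> f g /laurent_polynomialP[d fd] /laurent_polynomialP[e ge].
  apply/laurent_polynomialP; exists (d + e)%N => n nde.
  have -> : lcoef (f - g) n = f n - g n by [].
  by rewrite fd ?ge ?subr0//; move: nde; rewrite PoszD; lia.
move=> f g /laurent_polynomialP[d fd] /laurent_polynomialP[e ge].
apply/laurent_polynomialP; exists (d + e)%N => n nde.
apply: fsbig1 => i _.
have [di|id] := ltP d%:Z i; first by rewrite fd// mul0r.
by rewrite ge ?mulr0//; move: nde id; rewrite PoszD; lia.
Qed.

HB.instance Definition _ := GRing.isSubringClosed.Build laurent
  laurent_polynomial laurent_polynomial_subring.

(* The ring Z[q^{1/2}, q^{-1/2}]; the variable of the underlying Laurent series
   is q^{1/2}. *)
Record lpoly := LPoly {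
  lpoly_val : laurent;
  lpolyP : lpoly_val \in laurent_polynomial }.

HB.instance Definition _ := [isSub for lpoly_val].
HB.instance Definition _ := [Choice of lpoly by <:].
HB.instance Definition _ := [SubChoice_isSubComNzRing of lpoly by <:].

Lemma vpow_subproof k : laurent_mono k \in laurent_polynomial.
Proof.
apply/laurent_polynomialP; exists (absz k) => n kn; rewrite /= /mono.
by case: eqP => // nk; move: kn; rewrite nk; lia.
Qed.

(* q^{k/2} *)
Definition vpow (k : int) : lpoly := LPoly (vpow_subproof k).

Definition lpoly_q : lpoly := vpow 2.

Lemma expand_inf_subproof (a : lpoly) :
  (fun n : int => lpoly_val a (- n)) \in bounded_below.
Proof.
have /laurent_polynomialP[d ad] := lpolyP a.
by apply/bounded_belowP; exists d => n nd; apply: ad; lia.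
Qed.

(* The inclusions of Z[q^{1/2}, q^{-1/2}] in Z((q^{1/2})) and in Z((q^{-1/2}));
   the latter reverses the coefficients, because its variable is q^{-1/2}. *)
Definition expand_0 (a : lpoly) : laurent := lpoly_val a.
Definition expand_inf (a : lpoly) : laurent := Laurent (expand_inf_subproof a).

(* The value at q^{1/2} = y. *)
Definition lpoly_eval (R : realType) (y : R) (a : lpoly) : R :=
  \sum_(k \in [set: int]) (expand_0 a k)%:~R * y ^ k.

(* The value at q^{1/2} = y of the rational function P / Q whose expansion in
   Z((q^{-1/2})) is b. *)
Definition rat_value (R : realType) (y : R) (b : laurent) : R :=
  xget 0 [set r | exists P Q : lpoly,
    [/\ lpoly_eval y Q != 0, expand_inf Q * b = expand_inf P
      & r = lpoly_eval y P / lpoly_eval y Q]].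

(* The infinite dihedral group, by its normal forms: reduced words in the two
   generators are the words without two equal adjacent letters, and every
   element has exactly one. The letter false is s_0, the letter true is s_1. *)
Definition reduced (w : seq bool) := sorted (fun a b => a != b) w.

Definition push (s : bool) (w : seq bool) : seq bool :=
  if w is t :: w' then if s == t then w' else s :: w else [:: s].

Lemma push_reduced s w : reduced w -> reduced (push s w).
Proof.
case: w => //= t w tw; case: eqVneq => [_|st] /=; last by rewrite st.
by case: w tw => //= u w /andP[].
Qed.

Lemma pushK s w : reduced w -> push s (push s w) = w.
Proof.
case: w => [|t w] /=; first by rewrite eqxx.
case: eqVneq => [->|st]; last by rewrite /= eqxx.
by case: w => //= u w /andP[/negbTE->].
Qed.

Definition word_mul (x y : seq bool) := foldr push y x.

Lemma word_mul_reduced x y : reduced y -> reduced (word_mul x y).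
Proof. by move=> ry; elim: x => //= s x; exact: push_reduced. Qed.

Record affW := AffW { word :> seq bool; wordP : reduced word }.

HB.instance Definition _ := [isSub for word].
HB.instance Definition _ := [Choice of affW by <:].

Definition affW_one : affW := @AffW [::] isT.
Definition affW_mul (x y : affW) : affW :=
  AffW (word_mul_reduced x (wordP y)).

Lemma rev_reduced w : reduced w -> reduced (rev w).
Proof.
rewrite /reduced rev_sorted => rw.
by rewrite (@eq_sorted _ _ (fun a b => a != b))// => a b; rewrite eq_sym.
Qed.

Definition affW_inv (x : affW) : affW := AffW (rev_reduced (wordP x)).

Lemma word_mul_push s x z : reduced x -> reduced z ->
  word_mul (push s x) z = push s (word_mul x z).
Proof.
case: x => [|t x] //= rx rz; case: eqVneq => [->|//].
by rewrite pushK// word_mul_reduced.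
Qed.

Lemma affW_mulA : associative affW_mul.
Proof.
move=> x y z; apply: val_inj => /=; elim: (word x) => //= s w ->.
by rewrite word_mul_push ?wordP// word_mul_reduced// wordP.
Qed.

Lemma affW_mul1 : left_id affW_one affW_mul.
Proof. by move=> x; apply: val_inj. Qed.

Lemma word_mulr1 w : reduced w -> word_mul w [::] = w.
Proof.
elim: w => //= s w IHw sw.
have rw : reduced w by case: w sw {IHw} => //= t w /andP[].
rewrite IHw//; case: w sw {IHw rw} => //= t w /andP[/negbTE->] //.
Qed.

Lemma affW_mulr1 : right_id affW_one affW_mul.
Proof. by move=> x; apply: val_inj => /=; rewrite word_mulr1// wordP. Qed.

Lemma word_mulVl w z : reduced z -> word_mul (rev w) (word_mul w z) = z.
Proof.
move=> rz; elim: w => //= s w IHw.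
by rewrite rev_cons /word_mul foldr_rcons pushK// word_mul_reduced.
Qed.

Lemma affW_mulVl : left_inverse affW_one affW_inv affW_mul.
Proof.
move=> x; apply: val_inj => /=.
by rewrite -[X in word_mul _ X]word_mulr1 ?wordP// word_mulVl.
Qed.

Lemma affW_mulVr : right_inverse affW_one affW_inv affW_mul.
Proof.
move=> x; rewrite -[X in affW_mul X _](_ : affW_inv (affW_inv x) = x).
  exact: affW_mulVl.
by apply: val_inj => /=; rewrite revK.
Qed.

HB.instance Definition _ := isGroup.Build affW affW_mulA affW_mul1 affW_mulr1
  affW_mulVl affW_mulVr.

Definition gen (s : bool) : affW := @AffW [:: s] isT.

Definition ell (w : affW) : nat := size w.

Definition reflection (t : affW) : Prop :=
  exists (w : affW) (s : bool), t = (w * gen s * w^-1)%g.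

(* The strong Bruhat order: chains of right multiplications by reflections that
   increase the length. *)
Inductive bruhat (y : affW) : affW -> Prop :=
| bruhat_refl : bruhat y y
| bruhat_step (x t : affW) : bruhat y x -> reflection t ->
    (ell x < ell (x * t)%g)%N -> bruhat y (x * t)%g.

(* c is the family of coordinates of h with respect to the family B. *)
Definition expansion (H : lmodType lpoly) (B : affW -> H) (h : H)
    (c : affW -> lpoly) :=
  finite_set [set w | c w != 0] /\ h = \sum_(w \in [set: affW]) c w *: B w.

Definition is_basis (H : lmodType lpoly) (B : affW -> H) :=
  forall h, exists! c, expansion B h c.

Definition coord (H : lmodType lpoly) (B : affW -> H) (h : H) : affW -> lpoly :=
  xget (fun=> 0) [set c | expansion B h c].

Record is_hecke (H : algType lpoly) (T : affW -> H) : Prop := IsHecke {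
  hecke_basis : is_basis T;
  hecke_mul : forall w w', ell (w * w')%g = (ell w + ell w')%N ->
    T w * T w' = T (w * w')%g;
  hecke_quad : forall s, (T (gen s) + 1) * (T (gen s) - lpoly_q%:A) = 0 }.

Section KazhdanLusztig.
Variables (H : algType lpoly) (T : affW -> H).

Definition klC (w : affW) : H :=
  \sum_(y \in [set y | bruhat y w])
    ((-1) ^+ (ell w - ell y) * vpow ((ell w)%:Z - (ell y)%:Z)
      * vpow (- (ell y)%:Z)) *: T y.

Definition klC' (w : affW) : H :=
  vpow (- (ell w)%:Z) *: \sum_(y \in [set y | bruhat y w]) T y.

Definition hcoef (x y z : affW) : lpoly := coord klC (klC x * klC y) z.

End KazhdanLusztig.

Definition afun (w : affW) : nat := if w == 1%g then 0 else 1.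

Definition dist_inv : seq affW := [:: 1%g; gen false; gen true].

Section AsymptoticModule.
Variables (H : algType lpoly) (T : affW -> H).

(* The coefficient of t_z in phi(C_x). *)
Definition phi_coef (x z : affW) : lpoly :=
  \sum_(d <- dist_inv | afun d == afun z) hcoef T x d z.

(* A formal sum over a basis indexed by affW is the family of its
   coefficients; the following is the growth condition of the completions. *)
Definition in_completion (b : affW -> laurent) :=
  forall N : nat, (0 < N)%N -> exists L : nat, forall x, (L < ell x)%N ->
    forall k : int, k < N%:Z -> b x k = 0.

(* The sum over x is finite for every z, the coefficient of t_z in phi(C_x)
   being zero for all but finitely many x. *)
Definition phi_hat (b : affW -> laurent) (z : affW) : laurent :=
  \sum_(x \in [set: affW]) b x * expand_0 (phi_coef x z).

Definition phi_hat_inv (c : affW -> laurent) : affW -> laurent :=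
  xget (fun=> 0) [set b | in_completion b /\ phi_hat b = c].

(* The map j from sums in the basis C to sums in the basis C'. The involution
   of the coefficients maps Z((q^{1/2})) to Z((q^{-1/2})) by renaming the
   variable, hence does not change the sequence of coefficients. *)
Definition j_hat (b : affW -> laurent) (x : affW) : laurent :=
  (-1) ^+ ell x * b x.

(* Termwise sum of a family in which every power of the variable has finitely
   many nonzero coefficients. *)
Definition laurent_sum (F : affW -> laurent) : laurent :=
  insubd 0 (fun k : int => \sum_(x \in [set: affW]) F x k).

(* The coefficient of T_y in the formal sum of the c_x C'_x. *)
Definition T_coef (c : affW -> laurent) (y : affW) : laurent :=
  laurent_sum (fun x => c x * expand_inf (coord T (klC' T x) y)).

Definition t_basis (w z : affW) : laurent := (z == w)%:R.

(* b_{w,x}, as an element of Z((q^{-1/2})). *)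
Definition bcoef (w x : affW) : laurent :=
  T_coef (j_hat (phi_hat_inv (t_basis w))) x.

End AsymptoticModule.

Section Valuation.
Variables (F : fieldType) (v : F -> int).

(* The fractional ideal of elements of valuation at least n. The value v 0 is
   irrelevant. *)
Definition vball (n : int) : set F := [set x | x = 0 \/ n <= v x].

Definition ring_of_integers : set F := vball 0.

Definition integer_units : set F := [set x | x != 0 /\ v x = 0].

(* The cosets of the maximal ideal in the ring of integers. *)
Definition residue_classes : set (set F) :=
  [set [set y | vball 1 (y - x)] | x in ring_of_integers].

(* A field complete with respect to a normalized discrete valuation, with
   finite residue field. *)
Record is_local_field : Prop := IsLocalField {
  valM : forall x y, x != 0 -> y != 0 -> v (x * y) = v x + v y;
  valD : forall x y, x != 0 -> y != 0 -> x + y != 0 ->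
    Num.min (v x) (v y) <= v (x + y);
  val_normalized : exists2 x, x != 0 & v x = 1;
  val_complete : forall u : nat -> F,
    (forall n : int, exists N : nat, forall i j,
      (N <= i)%N -> (N <= j)%N -> vball n (u i - u j)) ->
    exists l, forall n : int, exists N : nat, forall i,
      (N <= i)%N -> vball n (u i - l);
  residue_finite : finite_set residue_classes }.

Definition is_uniformizer (pi : F) := pi != 0 /\ v pi = 1.

End Valuation.

Record SL2 (F : fieldType) := MkSL2 {
  SL2val :> 'M[F]_2;
  SL2P : \det SL2val == 1 }.

HB.instance Definition _ (F : fieldType) := [isSub for @SL2val F].
HB.instance Definition _ (F : fieldType) := [Choice of SL2 F by <:].

Section SL2Group.
Variable F : fieldType.

Lemma SL2_unit (g : SL2 F) : (g : 'M[F]_2) \in unitmx.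
Proof. by rewrite unitmxE (eqP (SL2P g)) unitr1. Qed.

Lemma SL2_one_subproof : \det (1%:M : 'M[F]_2) == 1.
Proof. by rewrite det1. Qed.
Definition SL2_one : SL2 F := MkSL2 SL2_one_subproof.

Lemma SL2_mul_subproof (g h : SL2 F) : \det ((g : 'M[F]_2) *m (h : 'M[F]_2)) == 1.
Proof. by rewrite det_mulmx (eqP (SL2P g)) (eqP (SL2P h)) mulr1. Qed.
Definition SL2_mul (g h : SL2 F) : SL2 F := MkSL2 (SL2_mul_subproof g h).

Lemma SL2_inv_subproof (g : SL2 F) : \det (invmx (g : 'M[F]_2)) == 1.
Proof. by rewrite det_inv (eqP (SL2P g)) invr1. Qed.
Definition SL2_inv (g : SL2 F) : SL2 F := MkSL2 (SL2_inv_subproof g).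

Lemma SL2_mulA : associative SL2_mul.
Proof. by move=> g h k; apply: val_inj => /=; rewrite mulmxA. Qed.

Lemma SL2_mul1 : left_id SL2_one SL2_mul.
Proof. by move=> g; apply: val_inj => /=; rewrite mul1mx. Qed.

Lemma SL2_mulr1 : right_id SL2_one SL2_mul.
Proof. by move=> g; apply: val_inj => /=; rewrite mulmx1. Qed.

Lemma SL2_mulVl : left_inverse SL2_one SL2_inv SL2_mul.
Proof. by move=> g; apply: val_inj => /=; rewrite mulVmx// SL2_unit. Qed.

Lemma SL2_mulVr : right_inverse SL2_one SL2_inv SL2_mul.
Proof. by move=> g; apply: val_inj => /=; rewrite mulmxV// SL2_unit. Qed.

HB.instance Definition _ := isGroup.Build (SL2 F) SL2_mulA SL2_mul1 SL2_mulr1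
  SL2_mulVl SL2_mulVr.
HB.instance Definition _ := isPointed.Build (SL2 F) SL2_one.

End SL2Group.

Definition mx2 (F : fieldType) (a b c d : F) : 'M[F]_2 :=
  \matrix_(i, j) (if i == 0 then if j == 0 then a else b
                  else if j == 0 then c else d).

Definition cv2 (F : fieldType) (a b : F) : 'cV[F]_2 :=
  \col_i (if i == 0 then a else b).

Section SL2Local.
Variables (F : fieldType) (v : F -> int).

Definition SL2_open : set (set (SL2 F)) :=
  [set U : set (SL2 F) | forall g : SL2 F, U g -> exists n : int, forall h : SL2 F,
    (forall i j, vball v n (h i j - g i j)) -> U h].

(* SL_2(F) with its Borel sigma-algebra. *)
Definition borelSL2 := g_sigma_algebraType SL2_open.

Definition iwahori : set (SL2 F) :=
  [set g : SL2 F | (forall i j, ring_of_integers v (g i j)) /\ vball v 1 (g 1 0)].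

Variable R : realType.

(* The left Haar measure for which the Iwahori subgroup, which is compact and
   open, has volume 1. *)
Definition is_haar (mu : {measure set borelSL2 -> \bar R}) :=
  mu iwahori = 1%E /\
  forall (g : SL2 F) (A : set borelSL2), measurable A ->
    mu [set (g * u)%g | u in (A : set (SL2 F))] = mu A.

Variable pi : F.

Definition lift_gen (s : bool) : 'M[F]_2 :=
  if s then mx2 0 pi^-1 (- pi) 0 else mx2 0 (-1) 1 0.

Definition lift (w : affW) : 'M[F]_2 :=
  foldr (fun s m => lift_gen s *m m) 1%:M w.

Definition double_coset (w : affW) : set (SL2 F) :=
  [set g : SL2 F | exists a b : SL2 F, [/\ iwahori a, iwahori b &
    (g : 'M[F]_2) = (a : 'M[F]_2) *m lift w *m (b : 'M[F]_2)]].

(* The function on SL_2(F) attached to t_w. At each point at most one term of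
   the sum is nonzero. *)
Definition t_fun (H : algType lpoly) (T : affW -> H) (q : nat) (w : affW)
    (g : SL2 F) : R :=
  \sum_(x \in [set: affW])
    rat_value (Num.sqrt (q%:R : R)) (bcoef T w x) * \1_(double_coset x) g.

Definition psi (n : int) : 'cV[F]_2 -> R :=
  \1_[set cv2 (pi ^ n * a) (pi ^ (n + 1) * b)
     | a in integer_units v & b in ring_of_integers v].

Definition varphi (n : int) : 'cV[F]_2 -> R :=
  \1_[set cv2 (pi ^ n * a) (pi ^ n * b)
     | a in ring_of_integers v & b in integer_units v].

Definition conv_integrand (f : SL2 F -> R) (h : 'cV[F]_2 -> R) (x : 'cV[F]_2)
    (u : borelSL2) : \bar R :=
  (f u * h (((u : SL2 F)^-1%g : 'M[F]_2) *m x))%:E.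

(* The convolution f * h is defined at x and has the value l there. *)
Definition conv_at (mu : {measure set borelSL2 -> \bar R})
    (f : SL2 F -> R) (h : 'cV[F]_2 -> R) (x : 'cV[F]_2) (l : R) :=
  mu.-integrable setT (conv_integrand f h x) /\
  (\int[mu]_u conv_integrand f h x u = l%:E)%E.

End SL2Local.

(* Main.v *)
Require Import Defs.
From mathcomp Require Import all_boot all_order all_algebra.
From mathcomp Require Import all_classical all_reals all_analysis.
From mathcomp Require Import measurable_realfun zify ring lra.
Require Import Defs.

(** The function t_1 is computed first. Write v = q^(1/2). Among the words
    with a given first letter, let b_m be the coefficient b_x for x of length m;
    the coefficient of t_x in phi (sum_x b_x C_x) is then
    b_(m-1) - (v + v^(-1)) b_m + b_(m+1) (phi_coef_alt, phi_hat_alt), because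
    C_x C_s is -(v + v^(-1)) C_x if x ends with s, and otherwise the sum of the
    C_z with z obtained by appending s to x or dropping its last letter, the
    latter only if x has length at least 2. The only
    solution of phi(b) = t_1 that decays is b_x = v^l(x) (chebyshev_decay,
    phi_hat_inv_t1). Applying j and summing a geometric series over the Bruhat
    order gives t_1 = c sum_w (-q)^(-l(w)) T_w with c = (q - 1) / (q + 1)
    (bcoef_rational, rat_value_bcoef).

    The series c sum_w (-q)^(-l(w)) T_w is not integrable on G, since I w I has
    volume q^l(w), but it converges against the indicators psi_m and phi_m. These
    are the indicators e_k of the layers L_k \ L_(k+1) of the chain of lattices
    L_k in F^2 stabilized by I, even k giving the psi_m and odd k the phi_m
    (psiE, varphiE). For each k one of the two generators satisfies
    T_s e_k = e_(k-1), the other T_s e_k = q e_(k+1) + (q - 1) e_k. In terms of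
    measures this is the decomposition of I s w I into q translates of I w I
    (double_coset_cons, coset_rep_inj), followed by the count of the translates
    of x in each layer (layer_down, layer_up); it yields a closed formula for
    T_w e_K (measure_fibre).

    Fix x in layer K + j. By this formula the terms of the series at x vanish for
    l(w) < |j|, are bounded by a geometric progression afterwards, and telescope:
    the partial sum over l(w) < N is 0 or, up to sign, c times a power of q^(-1)
    with exponent tending to infinity (cnt_len_series). So the integral converges
    absolutely and vanishes. *)

Set Implicit Arguments.
Unset Strict Implicit.
Unset Printing Implicit Defensive.

Import Order.TTheory GRing.Theory Num.Theory.
Import numFieldNormedType.Exports.
Local Open Scope classical_set_scope.
Local Open Scope ring_scope.

(** * Words in the infinite dihedral group *)

Fixpoint alt_word (a : bool) (n : nat) : seq bool :=
  if n is m.+1 then a :: alt_word (~~ a) m else [::].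

Lemma alt_word_reduced a n : reduced (alt_word a n).
Proof.
elim: n a => // -[//|n] IHn a; apply/andP; split; first by case: a.
exact: (IHn (~~ a)).
Qed.

(** Every element is the alternating word of its length that starts with its
    first letter; all later inductions run along these words. *)
Definition alt (a : bool) (n : nat) : affW := AffW (alt_word_reduced a n).

Lemma size_alt_word a n : size (alt_word a n) = n.
Proof. by elim: n a => //= n IHn a; rewrite IHn. Qed.

Lemma ell_alt a n : ell (alt a n) = n.
Proof. exact: size_alt_word. Qed.

Lemma reduced_cons s w : reduced (s :: w) -> w = alt_word (~~ s) (size w).
Proof.
elim: w s => //= t w IHw s /andP[st tw]; rewrite [in LHS](IHw t)//.
by have -> : t = ~~ s by case: s t st {tw} => -[].
Qed.

Lemma alt_ex (w : affW) : exists a, w = alt a (ell w).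
Proof.
case: w => -[|s w] rw; first by exists false; exact: val_inj.
by exists s; apply: val_inj; rewrite /= -(reduced_cons rw).
Qed.

Lemma alt0 a : alt a 0 = 1%g.
Proof. exact: val_inj. Qed.

Lemma alt1 a : alt a 1 = gen a.
Proof. exact: val_inj. Qed.

Lemma alt_inj a b m n : alt a m = alt b n -> m = n /\ ((0 < m)%N -> a = b).
Proof.
move=> abmn; have mn : m = n by rewrite -(ell_alt a m) abmn ell_alt.
split=> // m0; move: abmn => /(congr1 word); rewrite -mn.
by case: m m0 {mn} => //= m _ [].
Qed.

Lemma alt_same a i j : (alt a i == alt a j) = (i == j).
Proof. by apply/eqP/eqP => [/alt_inj[]|->]. Qed.

Lemma alt_eqS a b m n : (alt a m.+1 == alt b n) = (m.+1 == n) && (a == b).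
Proof.
apply/eqP/andP => [/alt_inj[mn ab]|[/eqP<- /eqP->]//].
by rewrite mn ab// !eqxx.
Qed.

Lemma alt_eq_one a n : (alt a n == 1%g) = (n == 0%N).
Proof. by rewrite -(alt0 a); case: n => [|n]; rewrite ?eqxx// alt_eqS. Qed.

Lemma ell_eq0 (w : affW) : (ell w == 0%N) = (w == 1%g).
Proof. by have [a ->] := alt_ex w; rewrite ell_alt alt_eq_one. Qed.

Lemma gen_mul_alt a n : (gen a * alt (~~ a) n)%g = alt a n.+1.
Proof. by apply: val_inj; case: n => //= n; case: a. Qed.

Lemma alt_mul_gen a n : (alt a n * gen (a (+) odd n))%g = alt a n.+1.
Proof.
elim: n a => [|n IHn] a; first by rewrite alt0 mul1g addbF alt1.
rewrite -gen_mul_alt -mulgA.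
have -> : a (+) odd n.+1 = ~~ a (+) odd n by rewrite /= addbN addNb.
by rewrite IHn gen_mul_alt.
Qed.

Lemma gen_mul_gen a : (gen a * gen a = 1)%g.
Proof. by apply: val_inj => /=; rewrite eqxx. Qed.

Lemma gen_inv a : ((gen a)^-1 = gen a)%g.
Proof. exact: val_inj. Qed.

Lemma odd_ell_mul (x y : affW) : odd (ell (x * y)%g) = odd (ell x) (+) odd (ell y).
Proof.
rewrite /ell /=; elim: (word x) => //= s w.
set u := word_mul w y; rewrite addNb => <-.
by case: u => //= t u; case: (s == t) => //=; rewrite negbK.
Qed.

Lemma ell_inv (x : affW) : ell (x^-1)%g = ell x.
Proof. by rewrite /ell /= size_rev. Qed.

(** Reduced words of odd length are palindromes, hence conjugates of their
    middle letter. *)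
Lemma reflection_alt a k : reflection (alt a k.*2.+1).
Proof.
elim: k a => [|k IHk] a; first by exists 1%g, a; rewrite alt1 mul1g invg1 mulg1.
have [w [s ws]] := IHk (~~ a).
exists (gen a * w)%g, s.
rewrite invgM gen_inv -!mulgA [X in (gen a * X)%g]mulgA [X in (gen a * X)%g]mulgA.
rewrite -ws mulgA gen_mul_alt -(alt_mul_gen a k.+1.*2).
by rewrite doubleS /= !negbK odd_double addbF.
Qed.

Lemma reflection_odd (t : affW) : odd (ell t) -> reflection t.
Proof.
have [a ->] := alt_ex t; rewrite ell_alt => ot.
by rewrite -(odd_double_half (ell t)) ot; exact: reflection_alt.
Qed.

(** Two elements whose lengths differ by an odd number differ by a reflection;
    in the other case an element of intermediate length links them. *)
Lemma bruhatE (y w : affW) : bruhat y w <-> y = w \/ (ell y < ell w)%N.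
Proof.
have step (u z x : affW) : bruhat u z -> (ell z < ell x)%N ->
    odd (ell z) (+) odd (ell x) -> bruhat u x.
  move=> uz zx ozx; rewrite -(mulVKg z x); apply: bruhat_step => //.
  - by apply: reflection_odd; rewrite odd_ell_mul ell_inv.
  - by rewrite mulVKg.
split=> [|[->|yw]]; last 2 first.
- exact: bruhat_refl.
- have [oyw|] := boolP (odd (ell y) (+) odd (ell w)).
    by apply: step oyw => //; exact: bruhat_refl.
  rewrite negb_add => /eqP oyw.
  pose z := alt true (ell y).+1.
  have yz : bruhat y z.
    apply: (step y y); rewrite ?ell_alt//=; first exact: bruhat_refl.
    by rewrite addbN addbb.
  apply: (step y z) => //; rewrite ell_alt; last by rewrite /= addNb oyw addbb.
  rewrite ltn_neqAle yw andbT; apply: contra_eq_neq oyw => <-.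
  by rewrite /= -addbT; case: odd.
elim=> [|x t _ [->|yx] _ xt]; first by left.
- by right.
- by right; exact: ltn_trans xt.
Qed.

Fixpoint ball (n : nat) : seq affW :=
  if n is m.+1 then
    (if m is 0 then [:: 1%g] else [:: alt false m; alt true m]) ++ ball m
  else [::].

Lemma mem_ball n w : (w \in ball n) = (ell w < n)%N.
Proof.
elim: n => //= n IHn; rewrite mem_cat IHn [RHS]ltnS [RHS]leq_eqVlt; congr orb.
have [a ->] := alt_ex w; move: (ell w) => k; rewrite ell_alt.
case: n {IHn} => [|n]; first by rewrite inE alt_eq_one.
by rewrite !inE ![alt a k == _]eq_sym !alt_eqS eq_sym; case: a; case: eqP.
Qed.

Lemma ball_uniq n : uniq (ball n).
Proof.
elim: n => //= n IHn; rewrite cat_uniq IHn andbT; apply/andP; split.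
  by case: n {IHn} => //= n; rewrite inE alt_eqS andbF.
apply/hasPn => w; rewrite mem_ball => wn; case: n {IHn} wn => // n wn.
by rewrite !inE; apply: contraTN wn => /orP[]/eqP->; rewrite ell_alt ltnn.
Qed.

(** Turns the sums over Bruhat intervals into sums over explicit lists, on which
    one can argue by induction on the length. *)
Lemma bruhat_ball w : [set y | bruhat y w] = [set` w :: ball (ell w)].
Proof.
apply/seteqP; split=> y /=; rewrite inE mem_ball.
  by move=> /bruhatE[->|->]; rewrite ?eqxx ?orbT.
by move=> /orP[/eqP->|yw]; apply/bruhatE; [left|right].
Qed.

Lemma ball_cons_uniq w : uniq (w :: ball (ell w)).
Proof. by rewrite /= mem_ball ltnn ball_uniq. Qed.

(** * Laurent series and Laurent polynomials *)

Lemma laurent_eqP (f g : laurent) : (forall n, f n = g n) -> f = g.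
Proof. by move=> fg; apply/val_inj/funext. Qed.

Lemma laurent_coefD (f g : laurent) n : (f + g) n = f n + g n.
Proof. by []. Qed.

Lemma laurent_coefN (f : laurent) n : (- f) n = - f n.
Proof. by []. Qed.

Lemma laurent_coefB (f g : laurent) n : (f - g) n = f n - g n.
Proof. by []. Qed.

Lemma laurent_coef_sum (I : Type) (r : seq I) (f : I -> laurent) n :
  (\sum_(i <- r) f i) n = \sum_(i <- r) f i n.
Proof. by elim: r => [|i r IHr]; rewrite ?big_nil// !big_cons -IHr. Qed.

Lemma laurent_monoM k (f : laurent) n : (laurent_mono k * f) n = f (n - k).
Proof.
rewrite [LHS](_ : _ = cauchy_prod (mono k) f n)// /cauchy_prod.
rewrite (@fsum_seq _ [:: k])//; first by rewrite big_seq1 /mono eqxx mul1r.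
by move=> i; rewrite inE /mono => /negbTE->; rewrite mul0r.
Qed.

Lemma laurent_mono_coef k n : laurent_mono k n = (n == k)%:R.
Proof. by []. Qed.

Lemma laurent_mono0 : laurent_mono 0 = 1.
Proof. by []. Qed.

Lemma laurent_monoD i j : laurent_mono (i + j) = laurent_mono i * laurent_mono j.
Proof.
apply: laurent_eqP => n; rewrite laurent_monoM !laurent_mono_coef.
by rewrite subr_eq addrC.
Qed.

Lemma laurent_signM (e : nat) (f : laurent) n :
  ((-1) ^+ e * f) n = (-1) ^+ e * f n.
Proof. by rewrite -signr_odd -[in RHS]signr_odd; case: odd; rewrite !(mulN1r, mul1r). Qed.

Lemma vpowD i j : vpow (i + j) = vpow i * vpow j.
Proof. by apply: val_inj; rewrite /= laurent_monoD. Qed.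

Lemma vpow0 : vpow 0 = 1.
Proof. exact: val_inj. Qed.

Lemma vpowNr i : vpow i * vpow (- i) = 1.
Proof. by rewrite -vpowD subrr vpow0. Qed.

Lemma vpowNl i : vpow (- i) * vpow i = 1.
Proof. by rewrite -vpowD addNr vpow0. Qed.

(** * Coordinates in a basis *)

Section Coordinates.
Variables (H : lmodType lpoly) (B : affW -> H).

Lemma expansion_seq (c : affW -> lpoly) (s : seq affW) : uniq s ->
  (forall w, w \notin s -> c w = 0) ->
  expansion B (\sum_(w <- s) c w *: B w) c.
Proof.
move=> us cs; split.
  apply: (@sub_finite_set _ _ [set` s]) => // w /=.
  by apply: contraTT => /cs->; rewrite eqxx.
rewrite (fsbig_seq _ _ us); apply: fsbig_widen => // w [_ /= /negP/cs->].
by rewrite scale0r.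
Qed.

Lemma expansion_on (h : H) c : expansion B h c -> exists s : seq affW,
  [/\ uniq s, forall w, w \notin s -> c w = 0 & h = \sum_(w <- s) c w *: B w].
Proof.
move=> [fc ->]; have [s us cs] : exists2 s : seq affW, uniq s &
    [set w | c w != 0] = [set` s].
  have /finite_seqP[s cs] := fc; exists (undup s); first exact: undup_uniq.
  by rewrite cs; apply/seteqP; split => w; rewrite /= mem_undup.
exists s; split=> //.
  move=> w ws; apply/eqP; apply: contraNT ws => cw.
  by have : [set w | c w != 0] w by []; rewrite cs.
rewrite (fsbig_seq _ _ us) -cs; apply/esym/fsbig_widen => // w [_ /= /negP].
by rewrite negbK => /eqP->; rewrite scale0r.
Qed.

Lemma expansion_lin a (h h' : H) c c' : expansion B h c -> expansion B h' c' ->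
  expansion B (a *: h + h') (fun w => a * c w + c' w).
Proof.
move=> /expansion_on[s [us cs ->]] /expansion_on[s' [us' cs' ->]].
have widen (d : affW -> lpoly) (r : seq affW) : uniq r -> {subset r <= undup (s ++ s')} ->
    (forall w, w \notin r -> d w = 0) ->
    \sum_(w <- r) d w *: B w = \sum_(w <- undup (s ++ s')) d w *: B w.
  move=> ur rss dr.
  rewrite (fsbig_seq _ _ ur) (fsbig_seq _ _ (undup_uniq _)).
  apply: fsbig_widen => // w [_ /= /negP/dr->]; exact: scale0r.
rewrite (widen c s)//; last by move=> w ws; rewrite mem_undup mem_cat ws.
rewrite (widen c' s')//; last by move=> w ws; rewrite mem_undup mem_cat ws orbT.
rewrite scaler_sumr -big_split /=.
rewrite (eq_bigr (fun w => (a * c w + c' w) *: B w)); last first.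
  by move=> w _; rewrite scalerDl scalerA.
apply: expansion_seq; first exact: undup_uniq.
move=> w; rewrite mem_undup mem_cat negb_or => /andP[/cs-> /cs'->].
by rewrite mulr0 addr0.
Qed.

Lemma coord_unique (h : H) c : expansion B h c ->
  (forall d, expansion B h d -> d = c) -> coord B h = c.
Proof. by move=> hc uc; apply: xget_unique. Qed.

Hypothesis basisB : is_basis B.

Lemma coordE (h : H) c : expansion B h c -> coord B h = c.
Proof.
move=> hc; apply: coord_unique => // d hd; have [e [_ eu]] := basisB h.
by rewrite -(eu c)// -(eu d).
Qed.

Lemma coordP (h : H) : expansion B h (coord B h).
Proof. by have [c [hc _]] := basisB h; rewrite (coordE hc). Qed.

Lemma coord_lin a (h h' : H) y :
  coord B (a *: h + h') y = a * coord B h y + coord B h' y.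
Proof. by rewrite (coordE (expansion_lin a (coordP h) (coordP h'))). Qed.

Lemma coord0 y : coord B 0 y = 0.
Proof.
by have := coord_lin (-1) 0 0 y; rewrite scaler0 addr0 mulN1r addNr.
Qed.

Lemma coordZ a (h : H) y : coord B (a *: h) y = a * coord B h y.
Proof. by rewrite -[a *: h]addr0 coord_lin coord0 addr0. Qed.

Lemma coord_sum (I : Type) (r : seq I) (F : I -> H) y :
  coord B (\sum_(i <- r) F i) y = \sum_(i <- r) coord B (F i) y.
Proof.
elim: r => [|i r IHr]; first by rewrite !big_nil coord0.
by rewrite !big_cons -IHr -[in LHS](scale1r (F i)) coord_lin mul1r.
Qed.

End Coordinates.

(** * Products of Kazhdan-Lusztig basis elements *)

Section Hecke.
Variables (H : algType lpoly) (T : affW -> H).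
Hypothesis hT : is_hecke T.

Let basisT := hecke_basis hT.

(** T_1 fixes every T_w on the left, hence every element, hence 1. *)
Lemma hecke_one : T 1%g = 1.
Proof.
have T1M h : T 1%g * h = h.
  have /expansion_on[s [_ _ ->]] := coordP basisT h.
  rewrite mulr_sumr; apply: eq_bigr => w _.
  by rewrite -scalerAr hecke_mul// mul1g.
by rewrite -[RHS]T1M mulr1.
Qed.

Lemma hecke_gen2 s : T (gen s) * T (gen s) =
  (vpow 2 - 1) *: T (gen s) + vpow 2 *: 1.
Proof.
apply/eqP; rewrite -subr_eq0 -(hecke_quad hT s) /lpoly_q; apply/eqP.
rewrite mulrDl mul1r mulrBr -scalerAr mulr1 scalerBl scale1r.
by rewrite !opprD opprK !addrA.
Qed.

(** The basis element (-q)^(-l(y)) T_y: right multiplication by 1 - q^(-1) T_s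
    sends it to the sum over the coset of y modulo s, up to a power of q. *)
Definition scaledT (y : affW) : H := ((-1) ^+ ell y * vpow (- 2 * (ell y)%:Z)) *: T y.

Lemma scaledT1 : scaledT 1%g = 1.
Proof. by rewrite /scaledT hecke_one mulr0 vpow0 mulr1 scale1r. Qed.

Lemma scaledT_mul_gen a n (s := a (+) odd n) :
  scaledT (alt a n) * scaledT (gen s) = scaledT (alt a n.+1).
Proof.
rewrite /scaledT -scalerAl -scalerAr scalerA !ell_alt -/(ell (gen s)).
have -> : ell (gen s) = 1%N by [].
rewrite (hecke_mul hT) alt_mul_gen ?ell_alt ?addn1//.
congr (_ *: _).
rewrite expr1 mulrACA exprSr; congr (_ * _).
by rewrite -vpowD; congr vpow; lia.
Qed.

Lemma scaledT_gen2 s : scaledT (gen s) * scaledT (gen s) =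
  (vpow (-2) - 1) *: scaledT (gen s) + vpow (-2) *: 1.
Proof.
have vv : vpow (-2) * vpow 2 = 1 by rewrite vpowNl.
rewrite /scaledT -scalerAl -scalerAr hecke_gen2 !scalerDr !scalerA expr1.
rewrite [-2 * _]mulr1; set x := vpow (-2) in vv *; set y := vpow 2 in vv *.
congr (_ *: _ + _ *: _); ring: vv.
Qed.

Definition sum_below (n : nat) : H := \sum_(y <- ball n) scaledT y.

(** C_w divided by (-1)^l(w) q^(l(w)/2), see klCE. *)
Definition scaledC (w : affW) : H := scaledT w + sum_below (ell w).

Lemma klCE w : klC T w = ((-1) ^+ ell w * vpow (ell w)%:Z) *: scaledC w.
Proof.
rewrite /klC bruhat_ball -(fsbig_seq _ _ (ball_cons_uniq w)).
rewrite /scaledC /sum_below -(big_cons _ _ w (ball _) xpredT) scaler_sumr.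
rewrite big_seq [RHS]big_seq; apply: eq_bigr => y; rewrite inE mem_ball => yw.
have {}yw : (ell y <= ell w)%N by case/orP: yw => [/eqP->|/ltnW].
rewrite /scaledT scalerA; congr (_ *: _); rewrite mulrACA -exprD -vpowD -mulrA -vpowD.
congr (_ * vpow _); last by lia.
by rewrite -signr_odd -[RHS]signr_odd oddB// oddD.
Qed.

Lemma sum_belowS n : (0 < n)%N ->
  sum_below n.+1 = sum_below n + scaledT (alt false n) + scaledT (alt true n).
Proof.
case: n => // n _; rewrite {1}/sum_below /= !big_cons.
by rewrite -[X in _ + (_ + X)]/(sum_below n.+1) addrA addrC addrA.
Qed.

Lemma sum_below1 : sum_below 1 = 1.
Proof. by rewrite /sum_below /= big_seq1 scaledT1. Qed.

Lemma sum_belowSb a n : (0 < n)%N ->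
  sum_below n.+1 = sum_below n + scaledT (alt a n) + scaledT (alt (~~ a) n).
Proof. by move=> n0; rewrite sum_belowS//; case: a => //; rewrite addrAC. Qed.

Lemma scaledC1 : scaledC 1%g = 1.
Proof. by rewrite /scaledC scaledT1 /sum_below big_nil addr0. Qed.

(** 1 - q^(-1) T_s squares to 1 + q^(-1) times itself, and the sum over a coset
    is a left multiple of it. *)
Lemma scaledT_pair a n (s := a (+) odd n) :
  (scaledT (alt a n) + scaledT (alt a n.+1)) * (1 + scaledT (gen s)) =
  (1 + vpow (-2)) *: (scaledT (alt a n) + scaledT (alt a n.+1)).
Proof.
rewrite -{1 2}scaledT_mul_gen -/s -[X in (X + _) * _]mulr1 -mulrDr -mulrA.
have -> : (1 + scaledT (gen s)) * (1 + scaledT (gen s)) =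
    (1 + vpow (-2)) *: (1 + scaledT (gen s)).
  rewrite mulrDl mul1r mulrDr mulr1 scaledT_gen2 scalerDr !scalerDl !scaleNr !scale1r.
  rewrite -!addrA; congr (1 + _).
  move: (scaledT _) (vpow _ *: scaledT _) (vpow _)%:A => t u w.
  by rewrite (addrCA u) addNKr addrA addrC.
by rewrite -scalerAr mulrDr mulr1 scaledT_mul_gen.
Qed.

End Hecke.

Lemma coord_sum_basis (H : lmodType lpoly) (B : affW -> H) (basisB : is_basis B)
    (s : seq affW) (a : affW -> lpoly) y : uniq s ->
  coord B (\sum_(w <- s) a w *: B w) y = if y \in s then a y else 0.
Proof.
move=> us; pose c w := if w \in s then a w else 0.
have -> : \sum_(w <- s) a w *: B w = \sum_(w <- s) c w *: B w.
  by apply: eq_big_seq => w ws; rewrite /c ws.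
by rewrite (coordE basisB (expansion_seq _ us _))// => w /negbTE ws; rewrite /c ws.
Qed.

Section Hecke.
Variables (H : algType lpoly) (T : affW -> H).
Hypothesis hT : is_hecke T.

Let basisT := hecke_basis hT.

Lemma scaledC_split a n :
  scaledC T (alt a n.+2) = (scaledT T (alt a n.+1) + scaledT T (alt a n.+2))
    + scaledC T (alt (~~ a) n.+1).
Proof.
rewrite /scaledC !ell_alt (sum_belowSb _ a)//.
exact: (AC (1*3) ((3*1)*(4*2))).
Qed.

Lemma scaledC_alt1 a : scaledC T (alt a 1) = 1 + scaledT T (gen a).
Proof. by rewrite /scaledC ell_alt sum_below1// alt1 addrC. Qed.

(** The interval below a word that ends with s is a union of cosets modulo s. *)
Lemma scaledC_mul_last a n (s := a (+) odd n) :
  scaledC T (alt a n.+1) * (1 + scaledT T (gen s)) = (1 + vpow (-2)) *: scaledC T (alt a n.+1).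
Proof.
rewrite {}/s; elim: n a => [|n IHn] a.
  rewrite scaledC_alt1; have := scaledT_pair hT a 0.
  by rewrite addbF alt0 alt1 scaledT1.
rewrite scaledC_split mulrDl scalerDr scaledT_pair//; congr (_ + _).
by rewrite -IHn /= addbN addNb.
Qed.

(** If x does not end with s, the cosets modulo s that meet the interval below x
    make up the interval below x s; those that lie inside it, which make up the
    interval below x without its last letter, contribute an additional q^(-1). *)
Lemma scaledC_mul_new a n (s := a (+) odd n) :
  scaledC T (alt a n.+2) * (1 + scaledT T (gen s)) =
  scaledC T (alt a n.+3) + vpow (-2) *: scaledC T (alt a n.+1).
Proof.
have sC3 : scaledC T (alt a n.+2) =
    scaledT T (alt a n.+2) + scaledT T (alt (~~ a) n.+1) + scaledC T (alt a n.+1).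
  rewrite /scaledC !ell_alt (sum_belowSb _ a)//.
  exact: (AC (1*3) ((1*4)*(3*2))).
rewrite {}/s {1}sC3 2!mulrDl scaledC_mul_last !mulrDr !mulr1.
have := scaledT_mul_gen hT a n.+2; rewrite /= negbK => ->.
have := scaledT_mul_gen hT (~~ a) n.+1; rewrite /= addbN addNb negbK => ->.
by rewrite !scaledC_split negbK scalerDl scale1r !addrA.
Qed.

Lemma klC1 : klC T 1%g = 1.
Proof. by rewrite klCE scaledC1// [ell 1%g]/= expr0 vpow0 mulr1 scale1r. Qed.

Lemma klC_gen s : klC T (gen s) = - vpow 1 *: (1 + scaledT T (gen s)).
Proof. by rewrite -!alt1 klCE scaledC_alt1 ell_alt expr1 mulN1r alt1. Qed.

Lemma klC_mul_last a n (s := a (+) odd n) :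
  klC T (alt a n.+1) * klC T (gen s) = - (vpow 1 + vpow (-1)) *: klC T (alt a n.+1).
Proof.
rewrite {}/s klC_gen klCE -scalerAr -scalerAl scaledC_mul_last !scalerA; congr (_ *: _).
rewrite (_ : vpow (-2) = vpow (-1) * vpow (-1)); last by rewrite -vpowD.
have := vpowNr 1; set x := vpow 1; set y := vpow (-1) => xy; ring: xy.
Qed.

Lemma klC_mul_new a n (s := a (+) odd n) :
  klC T (alt a n.+2) * klC T (gen s) = klC T (alt a n.+3) + klC T (alt a n.+1).
Proof.
rewrite {}/s klC_gen klCE -scalerAr -scalerAl scaledC_mul_new scalerDr !scalerA.
rewrite scalerDr !scalerA !klCE !ell_alt; congr (_ *: _ + _ *: _).
  rewrite !exprSr (_ : n.+3%:Z = n.+2%:Z + 1); last by lia.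
  by rewrite vpowD; ring.
rewrite !exprSr (_ : n.+2%:Z = n.+1%:Z + 1); last by lia.
rewrite vpowD (_ : vpow (-2) = vpow (-1) * vpow (-1)); last by rewrite -vpowD.
have := vpowNr 1; set x := vpow 1; set y := vpow (-1) => xy; ring: xy.
Qed.

Lemma klC_mul_new1 a : klC T (alt a 1) * klC T (gen (~~ a)) = klC T (alt a 2).
Proof.
rewrite alt1 !klC_gen -scalerAr -scalerAl klCE ell_alt scalerA scaledC_split scaledC_alt1 -!alt1.
have := scaledT_mul_gen hT a 1; rewrite addbT !alt1 => <-; rewrite mulrDl.
rewrite mul1r [1 + _ + _]addrC mulrDr mulr1; congr (_ *: _).
by rewrite mulrNN expr2 mulrNN !mul1r -vpowD.
Qed.

(** The matrix of the C_w in the basis T is triangular for the length, with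
    invertible diagonal entries. *)
Lemma coord_klC w y : (ell w <= ell y)%N ->
  coord T (klC T w) y = (y == w)%:R * vpow (- (ell w)%:Z).
Proof.
move=> wy; rewrite /klC bruhat_ball -(fsbig_seq _ _ (ball_cons_uniq w)).
rewrite coord_sum_basis ?ball_cons_uniq// inE mem_ball ltnNge wy orbF.
case: eqVneq => [->|_]; rewrite ?mul0r//.
by rewrite subnn subrr vpow0 expr0 !mul1r.
Qed.

Lemma coord_klC' w y : coord T (klC' T w) y =
  if y \in w :: ball (ell w) then vpow (- (ell w)%:Z) else 0.
Proof.
rewrite /klC' bruhat_ball -(fsbig_seq _ _ (ball_cons_uniq w)) coordZ//.
have -> : \sum_(i <- w :: ball (ell w)) T i = \sum_(i <- w :: ball (ell w)) 1 *: T i.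
  by apply: eq_bigr => i _; rewrite scale1r.
by rewrite coord_sum_basis ?ball_cons_uniq//; case: ifP; rewrite ?mulr1 ?mulr0.
Qed.

(** At an index of maximal length in the support, the T-coordinate of a linear
    relation between the C_w is a unit times the coefficient; so the
    coefficients vanish, by descending induction on the length. *)
Lemma klC_expansion_unique h c d :
  expansion (klC T) h c -> expansion (klC T) h d -> c = d.
Proof.
move=> hc hd; have := expansion_lin (-1) hc hd; rewrite scaleN1r addNr.
set e := (fun w => _); move=> /expansion_on[s [us es s0]].
suff e0 w : e w = 0.
  by apply/funext => w; have /eqP := e0 w; rewrite /e mulN1r addrC subr_eq0 => /eqP.
have [N] := ubnP (\max_(w <- s) ell w - ell w).
elim: N w => // N IHN w; rewrite ltnS => wN.
have [ws|/es//] := boolP (w \in s).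
have := congr1 (fun x => coord T x w) s0; rewrite coord0// coord_sum//.
rewrite (bigD1_seq w)//= big_seq_cond big1 => [|u /andP[us_ uw]]; last first.
  rewrite coordZ//; have [uw'|wu] := leqP (ell u) (ell w).
    by rewrite coord_klC// eq_sym (negbTE uw) mul0r mulr0.
  rewrite IHN ?mul0r//; apply: leq_trans wN.
  rewrite ltn_sub2l//; apply: leq_trans wu _.
  exact: leq_bigmax_seq.
rewrite addr0 coordZ// coord_klC// eqxx mul1r => /(congr1 ( *%R^~ (vpow (ell w)%:Z))).
by rewrite mul0r -mulrA vpowNl mulr1.
Qed.

Lemma hcoef_seq (x y : affW) (s : seq affW) (c : affW -> lpoly) z : uniq s ->
  klC T x * klC T y = \sum_(w <- s) c w *: klC T w ->
  hcoef T x y z = if z \in s then c z else 0.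
Proof.
move=> us xy; pose d w := if w \in s then c w else 0.
have hd : expansion (klC T) (klC T x * klC T y) d.
  rewrite xy (eq_big_seq (fun w => d w *: klC T w)) => [|w ws]; last by rewrite /d ws.
  by apply: expansion_seq => // w /negbTE ws; rewrite /d ws.
by rewrite /hcoef (coord_unique hd)// => e he; exact: klC_expansion_unique he hd.
Qed.

Lemma hcoef_one x z : hcoef T x 1%g z = (z == x)%:R.
Proof.
rewrite (@hcoef_seq _ _ [:: x] (fun=> 1))//; first by rewrite inE; case: eqP.
by rewrite klC1 mulr1 big_seq1 scale1r.
Qed.

(** The coefficient of C_z in C_x (C_(s_0) + C_(s_1)), which by definition of phi
    is that of t_z in phi(C_x) when z is nontrivial. *)
Definition gen_hcoef (x z : affW) := hcoef T x (gen false) z + hcoef T x (gen true) z.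

Lemma gen_hcoef1 z : gen_hcoef 1%g z = (ell z == 1%N)%:R.
Proof.
have hg s : hcoef T 1%g (gen s) z = (z == gen s)%:R.
  rewrite (@hcoef_seq _ _ [:: gen s] (fun=> 1))//; first by rewrite inE; case: eqP.
  by rewrite klC1 mul1r big_seq1 scale1r.
rewrite /gen_hcoef !hg; have [a ->] := alt_ex z; rewrite ell_alt -!alt1.
case: (ell z) => [|n]; first by rewrite alt0 ![_ == alt _ 1]eq_sym !alt_eq_one addr0.
by rewrite !alt_eqS; case: a; case: eqP => _; rewrite /= ?addr0 ?add0r.
Qed.

Lemma gen_hcoef_alt a n z : gen_hcoef (alt a n.+1) z =
  (z == alt a n.+2)%:R - (vpow 1 + vpow (-1)) * (z == alt a n.+1)%:R
  + ((0 < n)%N && (z == alt a n))%:R.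
Proof.
pose s := a (+) odd n.
have -> : gen_hcoef (alt a n.+1) z =
    hcoef T (alt a n.+1) (gen s) z + hcoef T (alt a n.+1) (gen (~~ s)) z.
  by rewrite /gen_hcoef; case: s => //; rewrite addrC.
have -> : hcoef T (alt a n.+1) (gen s) z =
    - ((vpow 1 + vpow (-1)) * (z == alt a n.+1)%:R).
  rewrite (@hcoef_seq _ _ [:: alt a n.+1] (fun=> - (vpow 1 + vpow (-1))))//.
    by rewrite inE; case: eqP; rewrite ?mulr1// mulr0 oppr0.
  by rewrite big_seq1 klC_mul_last.
rewrite addrAC addrC; congr (_ + _); rewrite {}/s -addbN.
case: n => [|n].
  rewrite (@hcoef_seq _ _ [:: alt a 2] (fun=> 1))//.
    by rewrite inE addr0; case: eqP.
  by rewrite addbT big_seq1 scale1r klC_mul_new1.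
rewrite (@hcoef_seq _ _ [:: alt a n.+3; alt a n.+1] (fun=> 1))//.
- rewrite !inE; case: eqVneq => [->|_] /=; last by rewrite add0r; case: eqP.
  by rewrite alt_eqS eqSS gtn_eqF ?addr0.
- by rewrite /= inE alt_eqS eqSS gtn_eqF.
- by rewrite big_cons big_seq1 !scale1r /= negbK klC_mul_new.
Qed.

Lemma phi_coef1 x : phi_coef T x 1%g = (x == 1%g)%:R.
Proof.
by rewrite /phi_coef /dist_inv /= !big_cons big_nil /= hcoef_one addr0 eq_sym.
Qed.

(** Multiplying on the right changes the last letter only, so phi acts
    separately on the words with a given first letter, where it is the
    three-term recursion of the Chebyshev polynomials. *)
Lemma phi_coef_alt x a m : phi_coef T x (alt a m.+1) =
  (x == alt a m)%:R - (vpow 1 + vpow (-1)) * (x == alt a m.+1)%:R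
  + (x == alt a m.+2)%:R.
Proof.
have -> : phi_coef T x (alt a m.+1) = gen_hcoef x (alt a m.+1).
  by rewrite /phi_coef /dist_inv /= !big_cons big_nil /afun alt_eq_one /= addr0.
have [b ->] := alt_ex x; case: (ell x) => [|n].
  rewrite alt0 gen_hcoef1 ell_alt !(eq_sym 1%g) !alt_eq_one /= mulr0 subr0 addr0.
  by rewrite eqSS.
rewrite gen_hcoef_alt !alt_eqS !eqSS !(eq_sym b) (eq_sym n) (eq_sym n).
by rewrite [m == n.+1]eq_sym; case: n.
Qed.

End Hecke.

Lemma fsum_on (I : choiceType) (V : nmodType) (F : I -> V) (s : seq I) : uniq s ->
  (forall i, i \notin s -> F i = 0) ->
  \sum_(i \in [set: I]) F i = \sum_(i <- s) F i.
Proof.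
move=> us F0; rewrite (fsbig_seq _ _ us) -(fsbig_widen [set` s] setT)//.
by move=> i [_ /negP /F0].
Qed.

(** * The inverse image of t_1 *)

Section Completion.
Variables (H : algType lpoly) (T : affW -> H).
Hypothesis hT : is_hecke T.

Lemma phi_hat1 b : phi_hat T b 1%g = b 1%g.
Proof.
rewrite /phi_hat (@fsum_on _ _ _ [:: 1%g])// => [|x].
  by rewrite big_seq1 phi_coef1// eqxx mulr1.
by rewrite inE phi_coef1// => /negbTE->; rewrite mulr0.
Qed.

Lemma phi_hat_alt b a m : phi_hat T b (alt a m.+1) =
  b (alt a m) - (laurent_mono 1 + laurent_mono (-1)) * b (alt a m.+1)
  + b (alt a m.+2).
Proof.
have e0 : (m == m.+1) = false by lia.
have e1 : (m == m.+2) = false by lia.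
rewrite /phi_hat (@fsum_on _ _ _ [:: alt a m; alt a m.+1; alt a m.+2]).
- rewrite !big_cons big_nil !phi_coef_alt// !alt_same !eqSS !eqxx.
  rewrite !(eq_sym m.+1 m) !(eq_sym m.+2 m) e0 e1.
  rewrite !(mulr0, mulr1, subr0, addr0, sub0r, add0r) addrA.
  have e0N p : expand_0 (- p) = - expand_0 p by [].
  by rewrite e0N mulrN [X in _ - X + _]mulrC.
- by rewrite /= !inE !alt_same eqSS e0 e1.
- move=> x; rewrite !inE !negb_or => /and3P[/negbTE x0 /negbTE x1 /negbTE x2].
  by rewrite phi_coef_alt// x0 x1 x2 mulr0 subr0 addr0 mulr0.
Qed.

(** Along the words with a given first letter, the equation phi(b) = t_1 is the
    recursion c_(m+2) = (v + v^-1) c_(m+1) - c_m; the combination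
    c_(m+1) - v c_m is multiplied by v^-1 at each step, so that the growth
    condition forces it to vanish. *)
Lemma chebyshev_decay (c : nat -> laurent) :
  (forall m, c m - (laurent_mono 1 + laurent_mono (-1)) * c m.+1 + c m.+2 = 0) ->
  (exists L : nat, forall m, (L < m)%N -> forall k : int, k < 1 -> c m k = 0) ->
  forall m, c m = laurent_mono m%:Z * c 0%N.
Proof.
move=> crec [L cL].
(* The characteristic polynomial has the roots v and v^-1; d kills the first. *)
pose d m := c m.+1 - laurent_mono 1 * c m.
have vv : laurent_mono 1 * laurent_mono (-1) = 1 by rewrite -laurent_monoD.
have dS m : laurent_mono 1 * d m.+1 = d m.
  rewrite /d; have := crec m; move: vv.
  move: (c m) (c m.+1) (c m.+2) (laurent_mono 1) (laurent_mono (-1)) => c0 c1 c2 x y xy e.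
  have {e} -> : c2 = (x + y) * c1 - c0.
    by apply/eqP; rewrite -subr_eq0 -e; apply/eqP; ring.
  ring: xy.
have d0E m j : d m = laurent_mono j%:Z * d (m + j)%N.
  elim: j => [|j ->]; first by rewrite laurent_mono0 mul1r addn0.
  by rewrite -dS addnS mulrA -laurent_monoD; congr (laurent_mono _ * _); lia.
have d0 m : d m = 0.
  apply: laurent_eqP => k; rewrite (d0E m (L + absz k).+1) laurent_monoM /d.
  rewrite laurent_coefB laurent_monoM !cL ?subr0//; lia.
elim=> [|m IHm]; first by rewrite laurent_mono0 mul1r.
have /eqP := d0 m; rewrite subr_eq0 => /eqP->.
by rewrite IHm mulrA -laurent_monoD; congr (laurent_mono _ * _); lia.
Qed.

Lemma phi_hat_inv_t1 : phi_hat_inv T (t_basis 1%g) = fun x => laurent_mono (ell x)%:Z.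
Proof.
apply: xget_unique => [|b [bc bt]].
  split.
    move=> N _; exists N => x Nx k kN; rewrite laurent_mono_coef.
    by case: eqP => // kx; move: kN; rewrite kx; lia.
  apply/funext => z; rewrite /t_basis; have [a ->] := alt_ex z.
  case: (ell z) => [|m]; first by rewrite alt0 phi_hat1 eqxx.
  rewrite phi_hat_alt !ell_alt alt_eq_one /= mulrDl -!laurent_monoD.
  rewrite (_ : 1 + m.+1%:Z = m.+2%:Z); last by lia.
  rewrite (_ : -1 + m.+1%:Z = m%:Z); last by lia.
  by rewrite [laurent_mono m.+2 + _]addrC opprD addNKr addNr.
apply/funext => x; have [a ->] := alt_ex x; rewrite ell_alt.
have b1 : b 1%g = 1 by rewrite -phi_hat1 bt /t_basis eqxx.
rewrite (@chebyshev_decay (fun m => b (alt a m))).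
- by rewrite alt0 b1 mulr1.
- by move=> m; rewrite -phi_hat_alt bt /t_basis alt_eq_one.
- have [L bL] := bc 1%N isT; exists L => m Lm k k1.
  by apply: bL => //; rewrite ell_alt.
Qed.

End Completion.

(** * The coefficients of t_1 *)

Lemma expand_inf_vpow k : expand_inf (vpow k) = laurent_mono (- k).
Proof.
apply: laurent_eqP => n; rewrite laurent_mono_coef /= /mono.
by rewrite eqr_oppLR.
Qed.

Section Bcoef.
Variables (H : algType lpoly) (T : affW -> H).
Hypothesis hT : is_hecke T.

Let bterm (y x : affW) : laurent :=
  j_hat (phi_hat_inv T (t_basis 1%g)) x * expand_inf (coord T (klC' T x) y).

Lemma bterm_coef y x k : bterm y x k =
  (if y \in x :: ball (ell x) then (-1) ^+ ell x else 0) * (k == 2 * (ell x)%:Z)%:R.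
Proof.
rewrite /bterm /j_hat phi_hat_inv_t1// coord_klC'//.
case: ifP => _; last first.
  rewrite mul0r (_ : expand_inf 0 = 0) ?mulr0//.
  exact: laurent_eqP.
rewrite expand_inf_vpow opprK -mulrA -laurent_monoD laurent_signM laurent_mono_coef.
by congr (_ * (_ == _)%:R); lia.
Qed.

Let level n : seq affW := if n is 0 then [:: 1%g] else [:: alt false n; alt true n].

Lemma mem_level n x : (x \in level n) = (ell x == n).
Proof.
case: n => [|n]; first by rewrite inE ell_eq0.
have [a ->] := alt_ex x; rewrite ell_alt !inE ![alt a _ == _]eq_sym !alt_eqS.
by rewrite -andb_orr eq_sym; case: a; rewrite andbT.
Qed.

Lemma level_uniq n : uniq (level n).
Proof. by case: n => //= n; rewrite inE alt_eqS andbF. Qed.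

(** Above y in the Bruhat order there are y itself and both elements of each
    greater length; the term of x has degree 2 l(x) and sign (-1)^l(x). *)
Lemma bterm_sum_even y n : \sum_(x \in [set: affW]) bterm y x (2 * n%:Z) =
  if (n < ell y)%N then 0 else if n == ell y then (-1) ^+ n else 2 * (-1) ^+ n.
Proof.
rewrite (@fsum_on _ _ _ (level n)) ?level_uniq// => [|x]; last first.
  rewrite mem_level bterm_coef => xn; rewrite (_ : _ == _ = false) ?mulr0//.
  by apply/negbTE; apply: contra xn => /eqP ?; apply/eqP; lia.
rewrite (eq_big_seq (fun x => if y \in x :: ball n then (-1) ^+ n else 0)); last first.
  by move=> x; rewrite mem_level bterm_coef => /eqP->; rewrite eqxx mulr1.
have [a yE] := alt_ex y; move: (ell y) yE => p ->; case: n => [|n].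
  rewrite big_seq1 !inE alt_eq_one /=.
  by case: p.
rewrite !big_cons big_nil !inE mem_ball ell_alt !(eq_sym (alt a p)) !alt_eqS.
rewrite ltnS; case: (ltngtP n.+1 p) => np /=.
- rewrite ifF ?ifF ?addr0//; lia.
- by rewrite -ltnS np addr0 -mulr2n mulr_natl.
- by rewrite -np ltnn; case: a; rewrite /= !(addr0, add0r).
Qed.

Lemma bterm_sum_other y k : (forall n : nat, k != 2 * n%:Z) ->
  \sum_(x \in [set: affW]) bterm y x k = 0.
Proof.
move=> kn; apply: fsbig1 => x _; rewrite bterm_coef (negbTE (kn _)); exact: mulr0.
Qed.

Lemma bcoef_coef y k : bcoef T 1%g y k = \sum_(x \in [set: affW]) bterm y x k.
Proof.
rewrite /bcoef /T_coef /laurent_sum val_insubd ifT//.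
apply/bounded_belowP; exists 0%N => n n0; apply: bterm_sum_other => m.
by apply: contraTneq n0 => ->; lia.
Qed.

(** With t = q^(-1/2), the series of b_(1,y) is the geometric series of
    (-1)^l t^(2l) (1 - t^2) / (1 + t^2), where l is the length of y. *)
Lemma bcoef_rational y (p := ell y) :
  expand_inf (1 + vpow (-2)) * bcoef T 1%g y =
  expand_inf ((-1) ^+ p * (vpow (- 2 * p%:Z) - vpow (- 2 * p%:Z - 2))).
Proof.
apply: laurent_eqP => k.
have eiD a b : expand_inf (a + b) = expand_inf a + expand_inf b by exact: laurent_eqP.
have eiB a b : expand_inf (a - b) = expand_inf a - expand_inf b by exact: laurent_eqP.
have ei1 : expand_inf 1 = 1 by rewrite -vpow0 expand_inf_vpow oppr0.
have eis (e : nat) a : expand_inf ((-1) ^+ e * a) = (-1) ^+ e * expand_inf a.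
  rewrite -signr_odd -[in RHS]signr_odd; case: odd; rewrite ?mul1r// !mulN1r.
  exact: laurent_eqP.
rewrite eis eiB eiD ei1 !expand_inf_vpow mulrDl mul1r laurent_coefD laurent_monoM.
rewrite laurent_signM laurent_coefB !laurent_mono_coef !bcoef_coef.
(* In odd or negative degrees both sides vanish. *)
have [[n ->]|kn] := pselect (exists n : nat, k = 2 * n%:Z); last first.
  rewrite !bterm_sum_other => [|n|n]; last 2 first.
  - by apply/eqP => kE; apply: kn; exists n.+1; lia.
  - by apply/eqP => kE; apply: kn; exists n.
  rewrite /p; have k1 : k != - (-2 * (ell y)%:Z).
    by apply/eqP => kE; apply: kn; exists (ell y); lia.
  have k2 : k != - (-2 * (ell y)%:Z - 2).
    by apply/eqP => kE; apply: kn; exists (ell y).+1; lia.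
  by rewrite (negbTE k1) (negbTE k2) subrr mulr0.
rewrite (_ : (_ == - (-2 * p%:Z)) = (n == p)); last by apply/eqP/eqP; lia.
rewrite (_ : (_ == - (-2 * p%:Z - 2)) = (n == p.+1)); last by apply/eqP/eqP; lia.
rewrite bterm_sum_even -/p; case: n => [|n].
  rewrite bterm_sum_other => [|n]; last by apply/eqP; lia.
  by rewrite subr0 addr0; case: (p) => [|p']; rewrite /= ?mulr0// expr0 mulr1.
rewrite (_ : 2 * n.+1%:Z - - -2 = 2 * n%:Z); last by lia.
rewrite bterm_sum_even -/p eqSS.
case: (ltngtP n.+1 p) => np.
- by rewrite /= (ltn_eqF (ltn_trans (ltnSn n) np)) subrr mulr0.
- have [->|np'] := eqVneq n p; rewrite exprSr /=; first by ring.
  by rewrite subrr mulr0; ring.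
- by rewrite -np (ltn_eqF (ltnSn n)) subr0 mulr1.
Qed.

End Bcoef.

(** * Specialization of the rational functions *)

(** Every Laurent polynomial is a combination of powers of the variable, so
    that multiplicativity need only be checked against these powers. *)
Lemma lpoly_sum_vpow (a : lpoly) : exists2 s : seq int, uniq s &
  (forall k, k \notin s -> lpoly_val a k = 0) /\
  a = \sum_(k <- s) vpow k *~ lpoly_val a k.
Proof.
have /bounded_belowP[m am] := lcoefP (lpoly_val a).
have /laurent_polynomialP[d ad] := lpolyP a.
pose s := [seq i%:Z - m%:Z | i <- iota 0 (m + d).+1].
have us : uniq s by rewrite map_inj_uniq ?iota_uniq// => i j /addIr[].
have a0 (k : int) : k \notin s -> lpoly_val a k = 0.
  move=> ks; have [/am//|mk] := ltP k (- m%:Z); have [/ad//|kd] := ltP d%:Z k.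
  case/mapP: ks; exists (absz (k + m%:Z)); last by lia.
  by rewrite mem_iota; lia.
exists s => //; split=> //; apply: val_inj; apply: laurent_eqP => n /=.
have valsum (r : seq int) (F : int -> lpoly) :
    lpoly_val (\sum_(k <- r) F k) = \sum_(k <- r) lpoly_val (F k).
  by elim: r => [|i r IHr]; rewrite ?big_nil// !big_cons -IHr.
have valmulz (x : lpoly) (z : int) : lpoly_val (x *~ z) n = lpoly_val x n * z.
  have nat_case (i : nat) : lpoly_val (x *+ i) n = lpoly_val x n * i%:Z.
    elim: i => [|i IHi]; first by rewrite mulr0.
    by rewrite mulrS [LHS]laurent_coefD IHi intS mulrDr mulr1.
  case: z => i; first exact: nat_case.
  by rewrite NegzE mulrNz [LHS]laurent_coefN nat_case mulrN.
rewrite valsum laurent_coef_sum.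
under eq_bigr do rewrite valmulz laurent_mono_coef.
have [ns|ns] := boolP (n \in s).
  rewrite (bigD1_seq n)//= eqxx mul1r big1 ?addr0// => i /negbTE.
  by rewrite eq_sym => ->; rewrite mul0r.
rewrite a0// big_seq big1// => i is_; case: eqP => [ni|_]; last by rewrite mul0r.
by rewrite ni is_ in ns.
Qed.

Lemma lpoly_morphM (A : comNzRingType) (f : lpoly -> A) :
  {morph f : a b / a - b} -> (forall a k, f (a * vpow k) = f a * f (vpow k)) ->
  {morph f : a b / a * b}.
Proof.
move=> fB fX a b.
have f0 : f 0 = 0 by rewrite -[in LHS](subrr 0) fB subrr.
have fN x : f (- x) = - f x by rewrite -sub0r fB f0 sub0r.
have fD x y : f (x + y) = f x + f y by rewrite -[in LHS](opprK y) fB fN opprK.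
have fsum (s : seq int) (F : int -> lpoly) :
    f (\sum_(k <- s) F k) = \sum_(k <- s) f (F k).
  by elim: s => [|i s IHs]; rewrite ?big_nil// !big_cons fD IHs.
have fz x z : f (x *~ z) = f x *~ z.
  have fn (i : nat) : f (x *+ i) = f x *+ i.
    by elim: i => [|i IHi]; rewrite ?mulr0n// !mulrS fD IHi.
  by case: z => i; rewrite ?NegzE ?mulrNz ?fN fn.
have [s _ [_ ->]] := lpoly_sum_vpow b.
rewrite mulr_sumr !fsum mulr_sumr; apply: eq_bigr => k _.
by rewrite mulrzAr !fz fX mulrzAr.
Qed.

Lemma expand_infB : {morph expand_inf : a b / a - b}.
Proof. by move=> a b; apply: laurent_eqP. Qed.

Lemma expand_infM : {morph expand_inf : a b / a * b}.
Proof.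
apply: lpoly_morphM expand_infB _ => a k; rewrite expand_inf_vpow.
apply: laurent_eqP => n; rewrite [in RHS]mulrC laurent_monoM.
rewrite -[LHS]/(lpoly_val (a * vpow k) (- n)) [a * _]mulrC laurent_monoM.
by rewrite -[RHS]/(lpoly_val a _); congr (lpoly_val a _); lia.
Qed.

Lemma expand_inf_inj : injective expand_inf.
Proof.
move=> a b ab; apply/val_inj/laurent_eqP => n.
by have := congr1 (fun f : laurent => f (- n)) ab; rewrite /= opprK.
Qed.

Section Specialization.
Variables (R : realType) (y : R).
Hypothesis y0 : y != 0.

Lemma lpoly_eval_seq (a : lpoly) (s : seq int) : uniq s ->
  (forall k, k \notin s -> lpoly_val a k = 0) ->
  lpoly_eval y a = \sum_(k <- s) (lpoly_val a k)%:~R * y ^ k.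
Proof.
by move=> us a0; rewrite /lpoly_eval (fsum_on us)// => k /a0 ak; rewrite /expand_0 ak mul0r.
Qed.

Lemma lpoly_evalB : {morph lpoly_eval y : a b / a - b}.
Proof.
move=> a b; have [s us [sa _]] := lpoly_sum_vpow a; have [r ur [rb _]] := lpoly_sum_vpow b.
pose t := undup (s ++ r).
have at0 k : k \notin t -> lpoly_val a k = 0.
  by rewrite mem_undup mem_cat negb_or => /andP[/sa].
have bt0 k : k \notin t -> lpoly_val b k = 0.
  by rewrite mem_undup mem_cat negb_or => /andP[_ /rb].
rewrite !(@lpoly_eval_seq _ t) ?undup_uniq// => [|k kt]; last first.
  by rewrite [LHS]laurent_coefB at0// bt0// subr0.
rewrite -sumrB; apply: eq_bigr => k _.
by rewrite [lpoly_val _ _]laurent_coefB rmorphB/= mulrBl.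
Qed.

Lemma lpoly_eval_vpow k : lpoly_eval y (vpow k) = y ^ k.
Proof.
rewrite (@lpoly_eval_seq _ [:: k])// => [|j]; first by rewrite big_seq1 /= /mono eqxx mul1r.
by rewrite inE /= /mono => /negbTE->.
Qed.

Lemma lpoly_evalM : {morph lpoly_eval y : a b / a * b}.
Proof.
apply: lpoly_morphM lpoly_evalB _ => a j; rewrite lpoly_eval_vpow.
have [s us [sa _]] := lpoly_sum_vpow a.
have coefM k : lpoly_val (a * vpow j) k = lpoly_val a (k - j).
  by rewrite [a * _]mulrC [LHS]laurent_monoM.
rewrite (@lpoly_eval_seq a s)// (@lpoly_eval_seq _ [seq k + j | k <- s]).
- rewrite big_map mulr_suml; apply: eq_bigr => k _.
  by rewrite coefM addrK expfzDr// mulrA.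
- by rewrite map_inj_uniq//; exact: addIr.
move=> k ks; rewrite coefM sa//; apply: contra ks => ks; apply/mapP.
by exists (k - j); rewrite ?subrK.
Qed.

(** Two fractions with the same expansion have the same cross products, and
    specialization is multiplicative; hence one fraction determines the value. *)
Lemma rat_value_eq (b : laurent) (P Q : lpoly) : lpoly_eval y Q != 0 ->
  expand_inf Q * b = expand_inf P ->
  rat_value y b = lpoly_eval y P / lpoly_eval y Q.
Proof.
move=> Q0 QP; apply: xget_unique => [|r [P' [Q' [Q'0 QP' ->]]]]; first by exists P, Q.
have PQ : P' * Q = P * Q'.
  apply: expand_inf_inj; rewrite !expand_infM -QP -QP'; ring.
by apply/eqP; rewrite eqr_div// -!lpoly_evalM PQ.
Qed.

End Specialization.

(** Up to a constant, t_1 is the sum of the (-q)^(-l(w)) T_w, a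
    matrix coefficient of the Steinberg representation. *)
Lemma rat_value_bcoef (R : realType) (H : algType lpoly) (T : affW -> H)
    (hT : is_hecke T) (q : nat) (w : affW) : (0 < q)%N ->
  rat_value (Num.sqrt (q%:R : R)) (bcoef T 1%g w) =
  (1 - q%:R^-1) / (1 + q%:R^-1) * (- q%:R^-1) ^+ ell w.
Proof.
move=> q_gt0; set y := Num.sqrt _.
have q0 : 0 < q%:R :> R by rewrite ltr0n.
have y0 : y != 0 by rewrite gt_eqF// sqrtr_gt0.
have y2 : y ^+ 2 = q%:R by rewrite sqr_sqrtr// ltW.
have yN2 : y ^ (-2) = q%:R^-1 by rewrite -y2.
have evalD a b : lpoly_eval y (a + b) = lpoly_eval y a + lpoly_eval y b.
  have ev0 : lpoly_eval y 0 = 0 by rewrite -[in LHS](subrr 0) lpoly_evalB// subrr.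
  by rewrite -[in LHS](opprK b) -[- b]sub0r !lpoly_evalB// ev0 sub0r opprK.
have eval1 : lpoly_eval y 1 = 1 by rewrite -vpow0 lpoly_eval_vpow// expr0z.
have evalX a n : lpoly_eval y (a ^+ n) = lpoly_eval y a ^+ n.
  by elim: n => [|n IHn]; rewrite ?expr0// !exprS lpoly_evalM// IHn.
have evalN1 : lpoly_eval y (-1) = -1.
  have -> : -1 = 1 - 1 - 1 :> lpoly by rewrite subrr sub0r.
  by rewrite !lpoly_evalB// eval1 subrr sub0r.
have evalQ : lpoly_eval y (1 + vpow (-2)) = 1 + q%:R^-1.
  by rewrite evalD eval1 lpoly_eval_vpow// yN2.
rewrite (rat_value_eq y0 _ (bcoef_rational hT w)); last first.
  by rewrite evalQ gt_eqF// addr_gt0// invr_gt0.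
rewrite evalQ lpoly_evalM// evalX evalN1 lpoly_evalB// !lpoly_eval_vpow//.
rewrite expfzDr// yN2 -exprz_exp yN2.
have -> : q%:R^-1 ^ (ell w)%:Z = q%:R^-1 ^+ ell w :> R by [].
by rewrite [in RHS]exprNn; ring.
Qed.

(** * Valuations *)

Section Valuation.
Variables (F : fieldType) (v : F -> int).
Hypothesis hF : is_local_field v.

Lemma val1 : v 1 = 0.
Proof.
have := valM hF (oner_neq0 F) (oner_neq0 F).
by rewrite mulr1 => /(congr1 (fun z => z - v 1)); rewrite subrr addrK.
Qed.

Lemma valN1 : v (-1) = 0.
Proof.
have N10 : -1 != 0 :> F by rewrite oppr_eq0 oner_neq0.
by have := valM hF N10 N10; rewrite mulrNN mulr1 val1; lia.
Qed.

Lemma valV x : x != 0 -> v x^-1 = - v x.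
Proof.
by move=> x0; have := valM hF x0 (invr_neq0 x0); rewrite divff// val1; lia.
Qed.

Lemma vball0 n : vball v n 0.
Proof. by left. Qed.

Lemma vballW m n x : n <= m -> vball v m x -> vball v n x.
Proof. by move=> nm [->|mx]; [left|right; exact: le_trans mx]. Qed.

Lemma vballM m n x y : vball v m x -> vball v n y -> vball v (m + n) (x * y).
Proof.
have [->|x0] := eqVneq x 0; first by rewrite mul0r => _ _; left.
have [->|y0] := eqVneq y 0; first by rewrite mulr0 => _ _; left.
move=> [/eqP|mx]; first by rewrite (negbTE x0).
move=> [/eqP|ny]; first by rewrite (negbTE y0).
by right; rewrite (valM hF)// lerD.
Qed.

Lemma vballN n x : vball v n x -> vball v n (- x).
Proof.
move=> nx; rewrite -mulN1r -[n]add0r; apply: vballM nx.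
by right; rewrite valN1.
Qed.

Lemma vballD n x y : vball v n x -> vball v n y -> vball v n (x + y).
Proof.
move=> [->|nx]; first by rewrite add0r.
move=> [->|ny]; first by rewrite addr0; right.
have [->|x0] := eqVneq x 0; first by rewrite add0r; right.
have [->|y0] := eqVneq y 0; first by rewrite addr0; right.
have [->|xy] := eqVneq (x + y) 0; first by left.
right; apply: le_trans (valD hF x0 y0 xy); by rewrite le_min nx.
Qed.

Lemma vballB n x y : vball v n x -> vball v n y -> vball v n (x - y).
Proof. by move=> nx /vballN; exact: vballD. Qed.

Lemma not_vball n x : ~ vball v n x -> x != 0 /\ v x < n.
Proof.
move=> nx; split; first by apply/eqP => x0; apply: nx; left.
by rewrite ltNge; apply/negP => ?; apply: nx; right.
Qed.

(** In a 2 x 2 matrix the entry in position (i, j) is given the degree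
    2 v + j - i, which is additive under multiplication; it is the filtration
    for which the Iwahori subgroup consists of the elements of degree at least
    0. The diagonal entries have even degree, the others odd degree. *)
Definition dball (e : int) : set F := [set x | x = 0 \/ e <= 2 * v x].

Lemma dball_vball e n x : (e == 2 * n) || (e == 2 * n - 1) ->
  dball e x <-> vball v n x.
Proof. by move=> en; split=> -[->|ex]; by [left|right; lia]. Qed.

Lemma dballW d e x : e <= d -> dball d x -> dball e x.
Proof. by move=> ed [->|dx]; [left|right; exact: le_trans dx]. Qed.

Lemma dballM d e x y : dball d x -> dball e y -> dball (d + e) (x * y).
Proof.
have [->|x0] := eqVneq x 0; first by rewrite mul0r => _ _; left.
have [->|y0] := eqVneq y 0; first by rewrite mulr0 => _ _; left.
move=> [/eqP|mx]; first by rewrite (negbTE x0).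
move=> [/eqP|ny]; first by rewrite (negbTE y0).
by right; rewrite (valM hF)//; lia.
Qed.

Lemma dballN e x : dball e x -> dball e (- x).
Proof.
by move=> ex; rewrite -mulN1r -[e]add0r; apply: dballM ex; right; rewrite valN1.
Qed.

Lemma dballD e x y : dball e x -> dball e y -> dball e (x + y).
Proof.
move=> [->|nx]; first by rewrite add0r.
move=> [->|ny]; first by rewrite addr0; right.
have [->|x0] := eqVneq x 0; first by rewrite add0r; right.
have [->|y0] := eqVneq y 0; first by rewrite addr0; right.
have [->|xy] := eqVneq (x + y) 0; first by left.
right; have := valD hF x0 y0 xy : Num.min (v x) (v y) <= v (x + y).
by rewrite ge_min => /orP[]; lia.
Qed.

Lemma dballB e x y : dball e x -> dball e y -> dball e (x - y).
Proof. by move=> nx /dballN; exact: dballD. Qed.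

Variable pi : F.
Hypothesis hpi : is_uniformizer v pi.

Lemma pi_neq0 : pi != 0. Proof. by case: hpi. Qed.
Lemma val_pi : v pi = 1. Proof. by case: hpi. Qed.

Lemma dball_piM e x : dball e (pi * x) <-> dball (e - 2) x.
Proof.
have [->|x0] := eqVneq x 0; first by rewrite mulr0; split=> _; left.
have p0 := pi_neq0; have px : pi * x != 0 by rewrite mulf_neq0.
split=> -[/eqP|ex]; rewrite ?(negbTE x0) ?(negbTE px)//; right; move: ex;
  rewrite (valM hF)// val_pi; lia.
Qed.

Lemma dball_piV e x : dball e (pi^-1 * x) <-> dball (e + 2) x.
Proof.
rewrite -{2}[x](mulVKf pi_neq0) dball_piM.
by rewrite addrK.
Qed.

Lemma dballNE e x : dball e (- x) <-> dball e x.
Proof. by split=> /dballN; rewrite ?opprK. Qed.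

(** * The Iwahori subgroup *)

Notation G := (SL2 F).
Notation I := (iwahori v).

Lemma mul2E m (A : 'M[F]_2) (B : 'M[F]_(2, m)) i j :
  (A *m B) i j = A i 0 * B 0 j + A i 1 * B 1 j.
Proof. by rewrite mxE big_ord_recl big_ord1; congr (_ + A i _ * B _ _); exact: val_inj. Qed.

Lemma ord2P (i : 'I_2) : i = 0 \/ i = 1.
Proof. by case: i => -[|[|//]] ?; [left|right]; apply: val_inj. Qed.

Lemma mx2_eq (A B : 'M[F]_2) : A 0 0 = B 0 0 -> A 0 1 = B 0 1 -> A 1 0 = B 1 0 ->
  A 1 1 = B 1 1 -> A = B.
Proof. by move=> ? ? ? ?; apply/matrixP => i j; case: (ord2P i) => ->; case: (ord2P j) => ->. Qed.

Lemma det2 (A : 'M[F]_2) : \det A = A 0 0 * A 1 1 - A 0 1 * A 1 0.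
Proof.
rewrite (expand_det_row _ 0) big_ord_recl big_ord1 /cofactor !det_mx11 !mxE /=.
rewrite expr0 expr1 mul1r mulN1r mulrN; congr (A _ _ * A _ _ - A _ _ * A _ _);
  exact: val_inj.
Qed.

Lemma mx2E (a b c d : F) : (mx2 a b c d 0 0 = a) * (mx2 a b c d 0 1 = b) *
  (mx2 a b c d 1 0 = c) * (mx2 a b c d 1 1 = d).
Proof. by rewrite !mxE. Qed.

Lemma SL2_mulE (g h : G) : ((g * h)%g : 'M[F]_2) = (g : 'M[F]_2) *m (h : 'M[F]_2).
Proof. by []. Qed.

Lemma SL2_oneE : ((1%g : G) : 'M[F]_2) = 1%:M.
Proof. by []. Qed.

Lemma SL2_detE (g : G) : g 0 0 * g 1 1 - g 0 1 * g 1 0 = 1.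
Proof. by rewrite -det2; exact/eqP/SL2P. Qed.

Lemma SL2_invE (g : G) :
  ((g^-1)%g : 'M[F]_2) = mx2 (g 1 1) (- g 0 1) (- g 1 0) (g 0 0).
Proof.
have gg : (g : 'M[F]_2) *m mx2 (g 1 1) (- g 0 1) (- g 1 0) (g 0 0) = 1%:M.
  have d := SL2_detE g.
  by apply: mx2_eq; rewrite mul2E !mx2E !mxE /= -?d; ring.
by rewrite -[RHS]mul1mx -[1%:M](mulVmx (SL2_unit g)) -mulmxA gg mulmx1.
Qed.

Let c (i : 'I_2) : int := (i : nat)%:Z.

Lemma iwahoriP (g : G) : I g <-> forall i j, dball (c i - c j) (g i j).
Proof.
split=> [[gO g1] i j|gd].
  case: (ord2P i) (ord2P j) => -> [] ->; rewrite /c /= ?subrr ?subr0 ?sub0r.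
  - by rewrite (@dball_vball _ 0)//; exact: gO.
  - by rewrite (@dball_vball _ 0)//; exact: gO.
  - by rewrite (@dball_vball _ 1).
  - by rewrite (@dball_vball _ 0)//; exact: gO.
split=> [i j|]; last by have := gd 1 0; rewrite (@dball_vball _ 1).
have := gd i j.
case: (ord2P i) (ord2P j) => -> [] ->; rewrite /c /= ?subrr ?subr0 ?sub0r.
- by rewrite (@dball_vball _ 0).
- by rewrite (@dball_vball _ 0).
- by rewrite (@dball_vball _ 1)//; exact: vballW.
- by rewrite (@dball_vball _ 0).
Qed.

Lemma iwahori1 : I 1%g.
Proof.
apply/iwahoriP => i j; rewrite SL2_oneE mxE; case: eqP => [->|_]; last by left.
by right; rewrite subrr val1.
Qed.

Lemma iwahoriM g h : I g -> I h -> I (g * h)%g.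
Proof.
move=> /iwahoriP Ig /iwahoriP Ih; apply/iwahoriP => i j; rewrite SL2_mulE mul2E.
apply: dballD; [rewrite -(subrK (c 0) (c i - c j))|rewrite -(subrK (c 1) (c i - c j))].
  have -> : c i - c j - c 0 + c 0 = (c i - c 0) + (c 0 - c j) by lia.
  exact: dballM.
have -> : c i - c j - c 1 + c 1 = (c i - c 1) + (c 1 - c j) by lia.
exact: dballM.
Qed.

Lemma iwahoriV g : I g -> I (g^-1)%g.
Proof.
move=> /iwahoriP Ig; apply/iwahoriP => i j; rewrite SL2_invE.
case: (ord2P i) (ord2P j) => -> [] ->; rewrite mx2E ?dballNE; exact: Ig.
Qed.

(** Off the diagonal the degree is odd, so that degree at least 0 is degree at
    least 1. *)
Lemma iwahori_off g i j : I g -> i != j -> dball (c i - c j + 1) (g i j).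
Proof.
move=> /iwahoriP Ig; case: (ord2P i) (ord2P j) => -> [] -> // _.
  by have := Ig 0 1; rewrite !(@dball_vball _ 0).
by have := Ig 1 0; rewrite !(@dball_vball _ 1).
Qed.

Definition row_ge (i : 'I_2) (d : int) (g : G) := forall j, dball (d + c i - c j) (g i j).

Lemma row_geW i d e g : e <= d -> row_ge i d g -> row_ge i e g.
Proof. by move=> ed gd j; apply: dballW (gd j); lia. Qed.

Lemma row_ge_mulr i d g k : I k -> row_ge i d g -> row_ge i d (g * k)%g.
Proof.
move=> /iwahoriP Ik gd j; rewrite SL2_mulE mul2E; apply: dballD.
  rewrite (_ : _ - _ = (d + c i - c 0) + (c 0 - c j)); last by lia.
  exact: dballM.
rewrite (_ : _ - _ = (d + c i - c 1) + (c 1 - c j)); last by lia.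
exact: dballM.
Qed.

Lemma row_ge_mull i i' d g k : I k -> i' != i -> row_ge i d g -> row_ge i' (d - 1) g ->
  row_ge i d (k * g)%g.
Proof.
move=> Ik ii' gd gd' j; rewrite SL2_mulE.
have kd : dball 0 (k i i) by have /iwahoriP/(_ i i) := Ik; rewrite subrr.
have ko : dball (c i - c i' + 1) (k i i') by apply: iwahori_off; rewrite // eq_sym.
suff -> : ((k : 'M[F]_2) *m (g : 'M[F]_2)) i j = k i i * g i j + k i i' * g i' j.
  apply: dballD; first by rewrite -[d + _ - _]add0r; exact: dballM.
  rewrite (_ : _ - _ = (c i - c i' + 1) + (d - 1 + c i' - c j)); last by lia.
  exact: dballM.
rewrite mul2E; case: (ord2P i) (ord2P i') ii' => -> [] -> //= _.
by rewrite addrC.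
Qed.

End Valuation.

Section DoubleCosets.
Variables (F : fieldType) (v : F -> int).
Hypothesis hF : is_local_field v.
Variable pi : F.
Hypothesis hpi : is_uniformizer v pi.

Notation G := (SL2 F).
Notation I := (iwahori v).

(** * Iwahori double cosets *)

Lemma lift_gen_det s : \det (lift_gen pi s) == 1.
Proof.
apply/eqP; rewrite det2; case: s; rewrite /lift_gen !mx2E; last by ring.
by field; exact: pi_neq0 hpi.
Qed.

Definition lift_genS s : G := MkSL2 (lift_gen_det s).

Definition liftS (w : seq bool) : G := foldr (fun s g => lift_genS s * g)%g 1%g w.

Lemma liftSE w : (liftS w : 'M[F]_2) = foldr (fun s m => lift_gen pi s *m m) 1%:M w.
Proof. by elim: w => //= s w <-. Qed.

Lemma double_cosetP w g : double_coset v pi w g <->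
  exists a b, [/\ I a, I b & g = (a * liftS w * b)%g].
Proof.
split=> -[a [b [Ia Ib gE]]]; exists a, b; split=> //.
  by apply: val_inj; rewrite /= gE liftSE.
by rewrite gE !SL2_mulE liftSE.
Qed.

Lemma double_coset_one g : double_coset v pi 1%g g <-> I g.
Proof.
split=> [/double_cosetP[a [b [Ia Ib ->]]]|Ig].
  by rewrite /= mulg1; exact: iwahoriM.
apply/double_cosetP; exists g, 1%g; split=> //; first exact: iwahori1.
by rewrite /= !mulg1.
Qed.

Lemma double_coset_mulr w g k : I k -> double_coset v pi w g ->
  double_coset v pi w (g * k)%g.
Proof.
move=> Ik /double_cosetP[a [b [Ia Ib ->]]]; apply/double_cosetP.
by exists a, (b * k)%g; split; rewrite ?mulgA//; exact: iwahoriM.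
Qed.

(** The row in which the elements of the double coset of a word with first
    letter s have their entry of least degree. *)
Definition lead_row (s : bool) : 'I_2 := if s then 0 else 1.

Lemma row_ge_lead s d g :
  row_ge v (lead_row s) d (lift_genS s * g)%g <-> row_ge v (lead_row (~~ s)) (d + 1) g.
Proof.
case: s; split=> gd j; have := gd j; rewrite SL2_mulE mul2E /lift_genS /lift_gen /= !mx2E.
- by rewrite mul0r add0r dball_piV//; congr (dball _ _ _); rewrite /=; lia.
- by rewrite mul0r add0r dball_piV//; congr (dball _ _ _); rewrite /=; lia.
- by rewrite mul0r mul1r [g 0 j + 0]addr0; congr (dball _ _ _); rewrite /=; lia.
- by rewrite mul0r mul1r [g 0 j + 0]addr0; congr (dball _ _ _); rewrite /=; lia.
Qed.

Lemma row_ge_other s d g :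
  row_ge v (lead_row (~~ s)) d (lift_genS s * g)%g <-> row_ge v (lead_row s) (d - 1) g.
Proof.
case: s; split=> gd j; have := gd j; rewrite SL2_mulE mul2E /lift_genS /lift_gen /= !mx2E.
- by rewrite mul0r [- pi * g 0 j + 0]addr0 mulNr dballNE// dball_piM//; congr (dball _ _ _); rewrite /=; lia.
- by rewrite mul0r [- pi * g 0 j + 0]addr0 mulNr dballNE// dball_piM//; congr (dball _ _ _); rewrite /=; lia.
- by rewrite mul0r [0 + -1 * g 1 j]add0r mulN1r dballNE//; congr (dball _ _ _); rewrite /=; lia.
- by rewrite mul0r [0 + -1 * g 1 j]add0r mulN1r dballNE//; congr (dball _ _ _); rewrite /=; lia.
Qed.

Lemma lift_rows a n : [/\ ~ row_ge v (lead_row a) (1 - n%:Z) (liftS (alt a n)),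
  row_ge v (lead_row a) (- n%:Z) (liftS (alt a n)),
  row_ge v (lead_row (~~ a)) (- n%:Z) (liftS (alt a n)) &
  (0 < n)%N -> row_ge v (lead_row (~~ a)) (1 - n%:Z) (liftS (alt a n))].
Proof.
elim: n a => [|n IHn] a.
  have row1 i : row_ge v i 0 1%g.
    move=> j; rewrite SL2_oneE mxE; case: eqP => [->|_]; last by left.
    by right; rewrite (val1 hF); lia.
  rewrite /= oppr0; split=> // /(_ (lead_row a)); rewrite SL2_oneE mxE eqxx.
  by case=> [/eqP|]; rewrite ?oner_eq0// (val1 hF); lia.
have [h1 h2 h3 _] := IHn (~~ a); rewrite negbK in h3.
rewrite [liftS _]/(lift_genS a * liftS (alt (~~ a) n))%g; split.
- by rewrite row_ge_lead (_ : _ + 1 = 1 - n%:Z); last by lia.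
- by rewrite row_ge_lead (_ : _ + 1 = - n%:Z); last by lia.
- by rewrite row_ge_other; apply: row_geW h3; lia.
- by move=> _; rewrite row_ge_other; apply: row_geW h3; lia.
Qed.

Lemma lead_row_neq a : lead_row (~~ a) != lead_row a.
Proof. by case: a. Qed.

Lemma lead_rowP a i : i = lead_row a \/ i = lead_row (~~ a).
Proof. by case: a; case: (ord2P i); auto. Qed.

Lemma double_coset_row a n g i : double_coset v pi (alt a n) g -> row_ge v i (- n%:Z) g.
Proof.
have [_ h2 h3 _] := lift_rows a n.
have row_all i' : row_ge v i' (- n%:Z) (liftS (alt a n)).
  by case: (lead_rowP a i') => ->.
move=> /double_cosetP[x [y [Ix Iy ->]]]; apply: row_ge_mulr => //.
apply: (@row_ge_mull _ _ hF i (lead_row (i != 0))) => //.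
  by case: (ord2P i) => ->.
by apply: row_geW (row_all _); lia.
Qed.

Lemma double_coset_row_other a n g : (0 < n)%N -> double_coset v pi (alt a n) g ->
  row_ge v (lead_row (~~ a)) (1 - n%:Z) g.
Proof.
have [_ h2 _ h4] := lift_rows a n.
move=> n0 /double_cosetP[x [y [Ix Iy ->]]]; apply: row_ge_mulr => //.
apply: (@row_ge_mull _ _ hF _ (lead_row a)) => //.
- by rewrite eq_sym lead_row_neq.
- exact: h4.
- by apply: row_geW h2; lia.
Qed.

Lemma double_coset_row_lead a n g : double_coset v pi (alt a n) g ->
  ~ row_ge v (lead_row a) (1 - n%:Z) g.
Proof.
move=> dg; have [h1 _ _ _] := lift_rows a n; apply: contra_not h1.
have := double_coset_row (lead_row (~~ a)) dg.
move: dg => /double_cosetP[x [y [Ix Iy gE]]] r' r.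
have -> : liftS (alt a n) = (x^-1 * (g * y^-1))%g.
  by rewrite gE mulgK mulKg.
apply: (@row_ge_mull _ _ hF _ (lead_row (~~ a))) => //.
- exact: iwahoriV.
- exact: lead_row_neq.
- by apply: row_ge_mulr => //; exact: iwahoriV.
- apply: row_ge_mulr => //; first exact: iwahoriV.
  by apply: row_geW r'; lia.
Qed.

(** The length of w and its first letter can be read off the degrees of the
    rows of any element of the double coset of w. *)
Lemma double_coset_inj w w' g : double_coset v pi w g -> double_coset v pi w' g -> w = w'.
Proof.
have [a ->] := alt_ex w; have [a' ->] := alt_ex w'.
move: (ell w) (ell w') => n n' dw dw'.
have le m m' b b' : double_coset v pi (alt b m) g -> double_coset v pi (alt b' m') g ->
    (m <= m')%N.
  move=> d d'; rewrite leqNgt; apply/negP => mm'.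
  apply: (double_coset_row_lead d); apply: row_geW (double_coset_row _ d'); lia.
have nn' : n = n' by apply/eqP; rewrite eqn_leq (le _ _ _ _ dw dw') (le _ _ _ _ dw' dw).
rewrite -nn' in dw' *; have [->|n0] := posnP n; first by rewrite !alt0.
have [->//|aa'] := eqVneq a a'.
have a'E : a' = ~~ a by case: a a' aa' {dw dw'} => -[].
case: (double_coset_row_lead dw); rewrite -[a]negbK -a'E.
exact: double_coset_row_other.
Qed.

(** * The affine root subgroups *)

Lemma root_elt_det s b :
  \det (if s then mx2 1 0 (pi * b) 1 else mx2 1 b 0 1 : 'M[F]_2) == 1.
Proof. by apply/eqP; rewrite det2; case: s; rewrite !mx2E; ring. Qed.

Definition root_elt s b : G := MkSL2 (root_elt_det s b).

Lemma root_eltD s b b' : (root_elt s b * root_elt s b' = root_elt s (b + b'))%g.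
Proof.
by apply/val_inj/mx2_eq; rewrite /= mul2E; case: s; rewrite !mx2E; ring.
Qed.

Lemma root_elt0 s : root_elt s 0 = 1%g.
Proof.
by apply/val_inj/mx2_eq; rewrite /= !mxE; case: s; rewrite !mx2E ?mulr0.
Qed.

Lemma root_eltN s b : ((root_elt s b)^-1 = root_elt s (- b))%g.
Proof. by apply: (mulgI (root_elt s b)); rewrite mulgV root_eltD subrr root_elt0. Qed.

Lemma iwahori_root s b : vball v 0 b -> I (root_elt s b).
Proof.
have O1 : vball v 0 1 by right; rewrite (val1 hF).
move=> b0; have b1 : vball v 1 (pi * b).
  by rewrite -[1]addr0; apply: vballM => //; right; rewrite (val_pi hpi).
split=> [i j|]; last by case: s; rewrite /= mx2E//; left.
case: (ord2P i) (ord2P j) => -> [] ->; case: s; rewrite /= mx2E//; try by left.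
exact: vballW b1.
Qed.

Lemma root_elt_conj s b :
  (root_elt s b * lift_genS (~~ s) = lift_genS (~~ s) * root_elt (~~ s) (- (pi * b)))%g.
Proof.
have p0 := pi_neq0 hpi.
apply/val_inj/mx2_eq; rewrite /= !mul2E; case: s; rewrite /= !mx2E;
 by field.
Qed.

(** If s w is longer than w, conjugation by w^-1 deepens the root subgroup of s. *)
Lemma root_elt_lift n s b : vball v 0 b -> exists2 k, I k &
  (root_elt s b * liftS (alt (~~ s) n) = liftS (alt (~~ s) n) * k)%g.
Proof.
elim: n s b => [|n IHn] s b b0.
  by exists (root_elt s b); [exact: iwahori_root|rewrite /= mulg1 mul1g].
have pb : vball v 0 (- (pi * b)).
  apply: vballN => //; apply: (@vballW _ _ 1) => //.
  by rewrite -[1]addr0; apply: vballM => //; right; rewrite (val_pi hpi).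
have [k Ik kE] := IHn (~~ s) _ pb; exists k => //.
rewrite [liftS _]/(lift_genS (~~ s) * liftS (alt (~~ ~~ s) n))%g.
by rewrite mulgA root_elt_conj -!mulgA kE.
Qed.

(** The elements of I that stay in I under conjugation by s are those whose
    component in the root subgroup of s is divisible by pi. *)
Lemma iwahori_conj s k : I k ->
  (if s then vball v 2 (k 1 0) else vball v 1 (k 0 1)) ->
  I ((lift_genS s)^-1 * k * lift_genS s)%g /\ I (lift_genS s * k * (lift_genS s)^-1)%g.
Proof.
move=> Ik ks; have p0 := pi_neq0 hpi.
pose t : F := if s then pi * pi else 1.
have t0 : t != 0 by rewrite /t; case: s {ks t}; rewrite ?oner_neq0// mulf_neq0.
pose A := mx2 (k 1 1) (- (k 1 0 * t^-1)) (- (k 0 1 * t)) (k 0 0).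
have e1 : ((lift_genS s)^-1 * k * lift_genS s)%g = A :> 'M[F]_2.
  rewrite !SL2_mulE SL2_invE; apply: mx2_eq; rewrite !mul2E /A /t; case: s {ks A t0 t};
    rewrite /= !mx2E; field; rewrite ?p0 ?oner_neq0 //.
have e2 : (lift_genS s * k * (lift_genS s)^-1)%g = A :> 'M[F]_2.
  rewrite !SL2_mulE SL2_invE; apply: mx2_eq; rewrite !mul2E /A /t; case: s {ks A t0 t e1};
    rewrite /= !mx2E; field; rewrite ?p0 ?oner_neq0 //.
have IA (g : G) : (g : 'M[F]_2) = A -> I g.
  have [kO k10] := Ik.
  have v2 : v (pi * pi) = 2 by rewrite (valM hF)// (val_pi hpi).
  move=> gA; split=> [i j|]; rewrite gA; last first.
    rewrite mx2E; apply: vballN => //; rewrite /t; case: s ks {A e1 e2 gA t t0} => ks.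
      rewrite -[1]add0r; apply: vballM => //; first exact: kO.
      by right; rewrite v2.
    by rewrite mulr1.
  case: (ord2P i) (ord2P j) => -> [] ->; rewrite mx2E; try exact: kO.
    apply: vballN => //; rewrite /t; case: s ks {A e1 e2 gA t t0} => ks.
      rewrite -[0](subrr 2); apply: vballM => //.
      by right; rewrite (valV hF) ?v2// mulf_neq0.
    by rewrite invr1 mulr1; exact: kO.
  apply: vballN => //; rewrite /t; case: s ks {A e1 e2 gA t t0} => ks.
    rewrite -[0]addr0; apply: vballM => //; first exact: kO.
    by right; rewrite v2.
  by rewrite mulr1; exact: kO.
by split; apply: IA.
Qed.

Section Residues.
Variables (q : nat) (rep : nat -> F).
Hypothesis rep_int : forall m, (m < q)%N -> vball v 0 (rep m).
Hypothesis rep_ex : forall x, vball v 0 x -> exists2 m, (m < q)%N & vball v 1 (x - rep m).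
Hypothesis rep_inj : forall m m', (m < q)%N -> (m' < q)%N ->
  vball v 1 (rep m - rep m') -> m = m'.

(** An element of I is reduced by a representative of its off-diagonal entry,
    multiplied by a diagonal entry; the determinant being 1, the error is a
    multiple of the square of that entry times the other one. *)
Lemma iwahori_factor s k : I k -> exists2 m, (m < q)%N & exists k',
  [/\ k = (root_elt s (rep m) * k')%g, I k',
   I ((lift_genS s)^-1 * k' * lift_genS s)%g & I (lift_genS s * k' * (lift_genS s)^-1)%g].
Proof.
move=> Ik; have [_ k10] := Ik; have kd := SL2_detE k.
have kO i j : vball v 0 (k i j) by have [kO _] := Ik; exact: kO.
have p0 := pi_neq0 hpi.
(* Modulo pi the diagonal entries are inverse to each other. *)
pose x := if s then pi^-1 * (k 1 0 * k 1 1) else k 0 1 * k 0 0.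
have x0 : vball v 0 x.
  rewrite /x; case: s {x}; last by rewrite -[0]addr0; exact: vballM.
  rewrite -[0](addNr 1); apply: vballM => //; last by rewrite -[1]addr0; apply: vballM.
  by right; rewrite (valV hF)// (val_pi hpi).
have [m mq xm] := rep_ex x0; exists m => //; exists (root_elt s (- rep m) * k)%g.
have Ik' : I (root_elt s (- rep m) * k)%g.
  by apply: iwahoriM => //; apply: iwahori_root; apply: vballN => //; exact: rep_int.
have [|i1 i2] := @iwahori_conj s _ Ik'; last first.
  by split=> //; rewrite mulgA root_eltD subrr root_elt0 mul1g.
rewrite SL2_mulE !mul2E; move: xm; rewrite /x; case: s {x x0 Ik'} => xm /=; rewrite !mx2E.
  have -> : pi * - rep m * k 0 0 + 1 * k 1 0 =
      pi * ((pi^-1 * (k 1 0 * k 1 1) - rep m) * k 0 0) - k 1 0 * k 1 0 * k 0 1.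
    rewrite -[1 * k 1 0](_ : k 1 0 * (k 0 0 * k 1 1 - k 0 1 * k 1 0) = _).
      by field.
    by rewrite kd mulr1 mul1r.
  apply: vballB => //.
    rewrite [2](_ : _ = 1 + (1 + 0))//; apply: vballM => //; last exact: vballM.
    by right; rewrite (val_pi hpi).
  by rewrite [2](_ : _ = 1 + 1 + 0)//; apply: vballM => //; exact: vballM.
have -> : 1 * k 0 1 + - rep m * k 1 1 =
    (k 0 1 * k 0 0 - rep m) * k 1 1 - k 0 1 * k 0 1 * k 1 0.
  rewrite -[1 * k 0 1](_ : k 0 1 * (k 0 0 * k 1 1 - k 0 1 * k 1 0) = _).
    by ring.
  by rewrite kd mulr1 mul1r.
apply: vballB => //; first by rewrite -[1]addr0; apply: vballM.
by rewrite [1](_ : _ = 0 + 0 + 1)//; apply: vballM => //; exact: vballM.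
Qed.

Definition coset_rep s m : G := (root_elt s (rep m) * lift_genS s)%g.

(** I s w I is the union of the translates of I w I by the coset
    representatives of I s I, when s w is longer than w. *)
Lemma double_coset_cons s n g : double_coset v pi (alt s n.+1) g <->
  exists2 m, (m < q)%N & double_coset v pi (alt (~~ s) n) ((coset_rep s m)^-1 * g)%g.
Proof.
have liftE : liftS (alt s n.+1) = (lift_genS s * liftS (alt (~~ s) n))%g by [].
split=> [/double_cosetP[x [y [Ix Iy ->]]]|[m mq /double_cosetP[x [y [Ix Iy]]]]].
  have [m mq [k [-> Ik Ik1 _]]] := iwahori_factor s Ix; exists m => //.
  apply/double_cosetP; exists ((lift_genS s)^-1 * k * lift_genS s)%g, y; split=> //.
  by rewrite /coset_rep liftE invgM -!mulgA mulKg.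
(* x is moved across s at the cost of a root element, which w absorbs. *)
move=> /(congr1 (fun h => coset_rep s m * h)%g); rewrite mulVKg => ->.
have [m' mq' [k [xE Ik _ Ik2]]] := iwahori_factor s (iwahoriV hF Ix).
have rm' : vball v 0 (- rep m') by apply: vballN => //; exact: rep_int.
have [z Iz zE] := root_elt_lift n s rm'.
have {xE} -> : x = (k^-1 * root_elt s (- rep m'))%g.
  by rewrite -[x]invgK xE invgM root_eltN.
apply/double_cosetP.
exists (root_elt s (rep m) * (lift_genS s * k * (lift_genS s)^-1)^-1)%g, (z * y)%g; split.
- apply: iwahoriM => //; first by apply: iwahori_root; exact: rep_int.
  exact: iwahoriV.
- exact: iwahoriM.
rewrite /coset_rep liftE !invgM invgK -!mulgA; congr (_ * (_ * (_ * _)))%g.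
by rewrite mulgA zE mulKg -!mulgA.
Qed.

(** Two of these translates meet only if the representatives agree: otherwise
    the leading row of an element of the intersection would be a multiple of
    the difference of two rows of too high degree. *)
Lemma coset_rep_inj s n g m m' : (m < q)%N -> (m' < q)%N ->
  double_coset v pi (alt (~~ s) n) ((coset_rep s m)^-1 * g)%g ->
  double_coset v pi (alt (~~ s) n) ((coset_rep s m')^-1 * g)%g -> m = m'.
Proof.
move=> mq mq' dm dm'; apply: rep_inj => //.
have dg : double_coset v pi (alt s n.+1) g by apply/double_coset_cons; exists m.
have {}dg := double_coset_row_lead dg.
have row_m l : (l < q)%N -> double_coset v pi (alt (~~ s) n) ((coset_rep s l)^-1 * g)%g ->
    row_ge v (lead_row (~~ s)) (1 - n%:Z) (root_elt s (- rep l) * g)%g.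
  move=> lq dl.
  have -> : (root_elt s (- rep l) * g = lift_genS s * ((coset_rep s l)^-1 * g))%g.
    by rewrite /coset_rep invgM -root_eltN -mulgA mulVKg.
  rewrite row_ge_other; apply: row_geW (double_coset_row _ dl); lia.
have {}dm := row_m _ mq dm; have {}dm' := row_m _ mq' dm'.
have [//|mm'] := pselect (vball v 1 (rep m - rep m')).
have [d0 d1] := not_vball mm'; case: dg => j.
have dV : dball v 0 (rep m - rep m')^-1 by right; rewrite (valV hF)//; lia.
have := dballB hF (dm' j) (dm j); rewrite !SL2_mulE !mul2E.
case: s {dm dm' row_m} => /=; rewrite !mx2E => d.
  have {}d : dball v (1 - n%:Z + 1 - (j : nat)%:Z) (pi * ((rep m - rep m') * g 0 j)).
    by move: d; congr (dball _ _ _); ring.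
  rewrite dball_piM// in d; have := dballM hF dV d.
  by rewrite mulKf//; apply: dballW; rewrite /=; lia.
have {}d : dball v (1 - n%:Z - (j : nat)%:Z) ((rep m - rep m') * g 1 j).
  by move: d; rewrite addr0; congr (dball _ _ _); ring.
by have := dballM hF dV d; rewrite mulKf//; apply: dballW; rewrite /=; lia.
Qed.

End Residues.
End DoubleCosets.

(** * Representatives of the residue classes *)

Section Residues.
Variables (F : fieldType) (v : F -> int).
Hypothesis hF : is_local_field v.

Lemma residue_reps (q : nat) : (residue_classes v #= `I_q)%card ->
  exists rep : nat -> F, [/\ forall m, (m < q)%N -> vball v 0 (rep m),
    forall x, vball v 0 x -> exists2 m, (m < q)%N & vball v 1 (x - rep m)
  & forall m m', (m < q)%N -> (m' < q)%N -> vball v 1 (rep m - rep m') -> m = m'].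
Proof.
rewrite card_eq_sym => /card_set_bijP[f [fq finj fsurj]].
have rep_ex m : exists x, (m < q)%N -> vball v 0 x /\ f m = [set y | vball v 1 (y - x)].
  have [mq|] := boolP (m < q)%N; last by exists 0.
  by have [x x0 fx] := fq m mq; exists x.
have [rep repP] := choice rep_ex; exists rep; split.
- by move=> m /repP[].
- move=> x x0; have [m mq fm] := fsurj [set y | vball v 1 (y - x)] (ex_intro2 _ _ x x0 erefl).
  exists m => //; have [_ fm'] := repP m mq.
  have : f m x by rewrite fm /=; rewrite subrr; exact: vball0.
  by rewrite fm'.
move=> m m' mq mq' mm'; apply: finj; rewrite ?inE//.
have [_ ->] := repP m mq; have [_ ->] := repP m' mq'.
apply/seteqP; split=> y /= yr.
  by rewrite -(subrKA (rep m)); exact: vballD.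
rewrite -(subrKA (rep m')); apply: vballD => //.
by rewrite -opprB; exact: vballN.
Qed.

(** 0 and 1 are incongruent. *)
Lemma residue_card_gt1 (q : nat) : (residue_classes v #= `I_q)%card -> (1 < q)%N.
Proof.
move=> /residue_reps[rep [_ rep_ex _]].
have v0 : vball v 0 0 by left.
have v1 : vball v 0 1 by right; rewrite (val1 hF).
have [m mq xm] := rep_ex 0 v0; have [m' mq' xm'] := rep_ex 1 v1.
have : m != m'.
  apply/eqP => mm'; move: xm'; rewrite -mm' => xm'.
  have := vballB hF xm' xm; rewrite sub0r opprK subrK.
  by case=> [/eqP|]; rewrite ?oner_eq0// (val1 hF).
lia.
Qed.

End Residues.

Section LatticeChain.
Variables (F : fieldType) (v : F -> int).
Hypothesis hF : is_local_field v.
Variable pi : F.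
Hypothesis hpi : is_uniformizer v pi.

Notation G := (SL2 F).
Notation I := (iwahori v).
Implicit Types (x : 'cV[F]_2) (s : bool) (n k : int).

(** * The chain of lattices stabilized by the Iwahori subgroup *)

Definition lattice (k : int) : set 'cV[F]_2 :=
  [set x | dball v k (x 0 0) /\ dball v (k + 1) (x 1 0)].

Definition layer (k : int) : set 'cV[F]_2 :=
  [set x | lattice k x /\ ~ lattice (k + 1) x].

Lemma latticeW k l x : k <= l -> lattice l x -> lattice k x.
Proof. by move=> kl [x0 x1]; split; [apply: dballW x0|apply: dballW x1]; lia. Qed.

Lemma layer_unique k l x : layer k x -> layer l x -> k = l.
Proof.
move=> [kx kx'] [lx lx']; have [kl|lk|//] := ltgtP k l.
  by case: kx'; apply: latticeW lx; lia.
by case: lx'; apply: latticeW kx; lia.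
Qed.

Lemma layer_ex x : x != 0 -> exists k, layer k x.
Proof.
have notd e y : y != 0 -> 2 * v y < e -> ~ dball v e y.
  by move=> y0 ye [/eqP|]; [rewrite (negbTE y0)|lia].
move=> x0; have ab0 : x 0 0 = 0 -> x 1 0 = 0 -> False.
  move=> a0 b0; move/eqP: x0; apply; apply/matrixP => i j; rewrite mxE ord1.
  by case: (ord2P i) => ->.
rewrite /layer /lattice /=; move: (x 0 0) (x 1 0) ab0 => a b ab0.
have [a0|a0] := eqVneq a 0.
  have b0 : b != 0 by apply/eqP; exact: ab0.
  exists (2 * v b - 1); split=> [|[_]]; first by split; [left|right; lia].
  by apply: notd => //; lia.
have [b0|b0] := eqVneq b 0.
  exists (2 * v a); split=> [|[+ _]]; first by split; [right|left].
  by apply: notd => //; lia.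
have [ab|ba] := leP (2 * v a) (2 * v b - 1).
  exists (2 * v a); split=> [|[+ _]]; first by split; right; lia.
  by apply: notd => //; lia.
exists (2 * v b - 1); split=> [|[_]]; first by split; right; lia.
by apply: notd => //; lia.
Qed.

Lemma lattice_iwahori k g x : I g -> lattice k x -> lattice k ((g : 'M[F]_2) *m x).
Proof.
move=> /(iwahoriP v)Ig [x0 x1]; split; rewrite mul2E; apply: dballD => //.
- by rewrite -[k]add0r; apply: dballM => //; exact: (Ig 0 0).
- rewrite (_ : k = -1 + (k + 1)); last by lia.
  by apply: dballM => //; exact: (Ig 0 1).
- by rewrite addrC; apply: dballM => //; exact: (Ig 1 0).
- by rewrite -[k + 1]add0r; apply: dballM => //; exact: (Ig 1 1).
Qed.

Lemma layer_iwahori k g x : I g -> layer k ((g : 'M[F]_2) *m x) <-> layer k x.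
Proof.
move=> Ig; have gx : ((g^-1)%g : 'M[F]_2) *m ((g : 'M[F]_2) *m x) = x.
  by rewrite mulmxA -SL2_mulE mulVg SL2_oneE mul1mx.
have latE l : lattice l ((g : 'M[F]_2) *m x) <-> lattice l x.
  split; last exact: lattice_iwahori.
  by rewrite -{2}gx; apply: lattice_iwahori; exact: iwahoriV.
by rewrite /layer /= !latE.
Qed.

(** Coordinates in which s_0 and s_1 both act by (X, Y) |-> (-Y, X), up to sign,
    and their root subgroups by translating X by multiples of Y; passing from
    s_0 to s_1 only shifts the numbering of the chain by one. *)
Let cX (s : bool) x : F := if s then pi^-1 * x 1 0 else x 0 0.
Let cY (s : bool) x : F := if s then x 0 0 else x 1 0.

Lemma lattice_even s n x :
  lattice (2 * n + (s : nat)%:Z) x <-> vball v n (cX s x) /\ vball v (n + 1) (cY s x).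
Proof.
rewrite /lattice /cX /cY /=; case: s.
  rewrite -(@dball_vball _ _ (2 * n)) ?eqxx// dball_piV//.
  rewrite -(@dball_vball _ _ (2 * n + 1)); last by apply/orP; right; lia.
  rewrite (_ : 2 * n + 1 + 1 = 2 * n + 2); last by lia.
  by split=> -[].
rewrite -(@dball_vball _ _ (2 * n)) ?eqxx//.
rewrite -(@dball_vball _ _ (2 * n + 1)); last by apply/orP; right; lia.
by rewrite addr0.
Qed.

Lemma lattice_odd s n x :
  lattice (2 * n + (s : nat)%:Z - 1) x <-> vball v n (cX s x) /\ vball v n (cY s x).
Proof.
rewrite /lattice /cX /cY /=; case: s.
  rewrite -(@dball_vball _ _ (2 * n - 1)); last by apply/orP; right.
  rewrite -(@dball_vball _ _ (2 * n)) ?eqxx// dball_piV//.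
  rewrite (_ : 2 * n + 1 - 1 = 2 * n); last by lia.
  rewrite (_ : 2 * n - 1 + 2 = 2 * n + 1); last by lia.
  by split=> -[].
rewrite -(@dball_vball _ _ (2 * n - 1)); last by apply/orP; right.
rewrite -(@dball_vball _ _ (2 * n)) ?eqxx//.
by rewrite addr0 subrK.
Qed.

Variables (rep : nat -> F).

Definition coset_pull s m x : 'cV[F]_2 :=
  (((coset_rep hpi rep s m)^-1)%g : 'M[F]_2) *m x.

Lemma cX_pull s m x : cX s (coset_pull s m x) = cY s x.
Proof.
have p0 := pi_neq0 hpi.
rewrite /coset_pull /coset_rep invgM root_eltN SL2_mulE -mulmxA SL2_invE /cX /cY.
by case: s => /=; rewrite !mul2E /= !mx2E ?mul2E /= ?mx2E; field.
Qed.

Lemma cY_pull s m x : cY s (coset_pull s m x) = rep m * cY s x - cX s x.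
Proof.
have p0 := pi_neq0 hpi.
rewrite /coset_pull /coset_rep invgM root_eltN SL2_mulE -mulmxA SL2_invE /cX /cY.
by case: s => /=; rewrite !mul2E /= !mx2E ?mul2E /= ?mx2E; field.
Qed.

Variable q : nat.
Hypothesis rep_int : forall m, (m < q)%N -> vball v 0 (rep m).
Hypothesis rep_ex : forall y, vball v 0 y -> exists2 m, (m < q)%N & vball v 1 (y - rep m).
Hypothesis rep_inj : forall m m', (m < q)%N -> (m' < q)%N ->
  vball v 1 (rep m - rep m') -> m = m'.

(** Here s does not preserve the outer lattice of the layer, and all the
    translates of x by the coset representatives of I s I move to the next outer
    layer. *)
Lemma layer_down s n x m : (m < q)%N -> layer (2 * n + (s : nat)%:Z) x ->
  layer (2 * n + (s : nat)%:Z - 1) (coset_pull s m x).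
Proof.
move=> mq [/lattice_even[X0 Y0] xn].
have Z0 : vball v n (rep m * cY s x - cX s x).
  apply: vballB => //; rewrite -[n]add0r; apply: vballM => //; first exact: rep_int.
  by apply: vballW Y0; lia.
split.
  by rewrite lattice_odd cX_pull cY_pull; split=> //; apply: vballW Y0; lia.
rewrite subrK lattice_even cX_pull cY_pull => -[_ Z1]; apply: xn.
rewrite (_ : _ + 1 = 2 * (n + 1) + (s : nat)%:Z - 1); last by lia.
rewrite lattice_odd; split=> //.
rewrite -[cX s x](subKr (rep m * cY s x)); apply: vballB => //.
by rewrite -[n + 1]add0r; apply: vballM => //; exact: rep_int.
Qed.

(** Here s preserves the outer lattice of the layer. Modulo pi this lattice is a
    plane over the residue field, and the translates are the q points of an
    affine line in it, one of which lies on the line of the inner lattice. *)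
Lemma layer_up s n x : layer (2 * n + (s : nat)%:Z - 1) x ->
  exists2 m0, (m0 < q)%N & forall m, (m < q)%N ->
  layer (if m == m0 then 2 * n + (s : nat)%:Z else 2 * n + (s : nat)%:Z - 1)
    (coset_pull s m x).
Proof.
move=> [/lattice_odd[X0 Y0]]; rewrite subrK lattice_even => xn.
have /not_vball[Y_neq0 vY] : ~ vball v (n + 1) (cY s x) by move=> Y1; apply: xn.
have {}vY : v (cY s x) = n by case: Y0 => [/eqP|]; [rewrite (negbTE Y_neq0)|lia].
have vYV : vball v (- n) (cY s x)^-1 by right; rewrite (valV hF)// vY.
have r0 : vball v 0 (cX s x / cY s x) by rewrite -(subrr n); exact: vballM.
have ZE m : rep m * cY s x - cX s x = - ((cX s x / cY s x - rep m) * cY s x).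
  by rewrite mulrBl divfK// opprB.
have [m0 m0q m0r] := rep_ex r0; exists m0 => // m mq.
have Z0 : vball v n (rep m * cY s x - cX s x).
  by apply: vballB => //; rewrite -[n]add0r; apply: vballM => //; exact: rep_int.
have ZP : vball v (n + 1) (rep m * cY s x - cX s x) <-> m = m0.
  split=> [Z1|->]; last first.
    by rewrite ZE addrC; apply: vballN => //; apply: vballM => //; right; rewrite vY.
  apply: rep_inj => //; rewrite -(subrKA (cX s x / cY s x)); apply: vballD => //.
  rewrite -opprB; apply: vballN => //.
  rewrite (_ : _ - _ = - ((rep m * cY s x - cX s x) * (cY s x)^-1)).
    by rewrite [1](_ : _ = n + 1 - n); [apply: vballN => //; exact: vballM|lia].
  by rewrite mulrBl mulfK// opprB.
case: eqP => mm0; split.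
- by rewrite lattice_even cX_pull cY_pull; split=> //; exact/ZP.
- rewrite (_ : _ + 1 = 2 * (n + 1) + (s : nat)%:Z - 1); last by lia.
  rewrite lattice_odd cX_pull => -[[/eqP|]]; first by rewrite (negbTE Y_neq0).
  by rewrite vY; lia.
- by rewrite lattice_odd cX_pull cY_pull.
- by rewrite subrK lattice_even cX_pull cY_pull => -[_ /ZP].
Qed.

End LatticeChain.

(** * The functions psi_n and phi_n as indicators of layers *)

Section Orbits.
Variables (F : fieldType) (v : F -> int).
Hypothesis hF : is_local_field v.
Variable pi : F.
Hypothesis hpi : is_uniformizer v pi.

Lemma val_piX (n : int) : v (pi ^ n) = n.
Proof.
have p0 := pi_neq0 hpi.
have vX (k : nat) : v (pi ^+ k) = k%:Z.
  elim: k => [|k IHk]; first by rewrite expr0 (val1 hF).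
  by rewrite exprS (valM hF) ?expf_neq0// (val_pi hpi) IHk; lia.
case: n => k; first exact: vX.
by rewrite NegzE -exprnN (valV hF) ?expf_neq0// vX.
Qed.

Lemma piX_neq0 (n : int) : pi ^ n != 0.
Proof. by rewrite expfz_neq0// (pi_neq0 hpi). Qed.

Lemma vball_piX (m n : int) x : vball v m x -> vball v (n + m) (pi ^ n * x).
Proof. by move=> mx; apply: vballM mx => //; right; rewrite val_piX. Qed.

Lemma cv2K (x : 'cV[F]_2) : cv2 (x 0 0) (x 1 0) = x.
Proof. by apply/matrixP => i j; rewrite mxE ord1; case: (ord2P i) => ->. Qed.

Lemma cv2E (a b : F) : (cv2 a b 0 0 = a) * (cv2 a b 1 0 = b).
Proof. by rewrite !mxE. Qed.

Lemma piXK (n : int) (x : F) : pi ^ n * (pi ^ (- n) * x) = x.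
Proof. by rewrite mulrA -expfzDr ?(pi_neq0 hpi)// subrr expr0z mul1r. Qed.

Lemma lattice_evenE n x : lattice v (2 * n) x <-> vball v n (x 0 0) /\ vball v (n + 1) (x 1 0).
Proof. by have := lattice_even hF hpi false n x; rewrite addr0. Qed.

Lemma lattice_oddE n x : lattice v (2 * n - 1) x <-> vball v n (x 0 0) /\ vball v n (x 1 0).
Proof. by have := lattice_odd hF hpi false n x; rewrite addr0. Qed.

Lemma psiE (R : realType) n : psi v R pi n = \1_(layer v (2 * n)).
Proof.
rewrite /psi; congr (\1_ _); apply/seteqP; split=> x /=.
  move=> [a [a0 va] [b b0 <-]]; have va' : v (pi ^ n * a) = n.
    by rewrite (valM hF) ?piX_neq0// val_piX va addr0.
  split.
    rewrite lattice_evenE !cv2E; split; first by right; rewrite va'.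
    by have := vball_piX (n + 1) b0; rewrite addr0.
  rewrite (_ : 2 * n + 1 = 2 * (n + 1) - 1); last by lia.
  rewrite lattice_oddE !cv2E => -[[/eqP|]]; last by rewrite va'; lia.
  by rewrite mulf_eq0 (negbTE (piX_neq0 n)) (negbTE a0).
move=> [/lattice_evenE[x0 x1]].
rewrite (_ : 2 * n + 1 = 2 * (n + 1) - 1); last by lia.
rewrite lattice_oddE => x01.
have /not_vball[x00 vx] : ~ vball v (n + 1) (x 0 0) by move=> x0'; apply: x01.
have vxn : v (x 0 0) = n by case: x0 => [/eqP|]; [rewrite (negbTE x00)|lia].
exists (pi ^ (- n) * x 0 0).
  split; first by rewrite mulf_neq0// piX_neq0.
  by rewrite (valM hF) ?piX_neq0// val_piX vxn addNr.
exists (pi ^ (- (n + 1)) * x 1 0); last by rewrite !piXK cv2K.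
by rewrite /ring_of_integers -(addNr (n + 1)); exact: vball_piX.
Qed.

Lemma varphiE (R : realType) n : varphi v R pi n = \1_(layer v (2 * n - 1)).
Proof.
rewrite /varphi; congr (\1_ _); apply/seteqP; split=> x /=.
  move=> [a a0 [b [b0 vb] <-]]; have vb' : v (pi ^ n * b) = n.
    by rewrite (valM hF) ?piX_neq0// val_piX vb addr0.
  split.
    rewrite lattice_oddE !cv2E; split; last by right; rewrite vb'.
    by have := vball_piX n a0; rewrite addr0.
  rewrite subrK lattice_evenE !cv2E => -[_ [/eqP|]]; last by rewrite vb'; lia.
  by rewrite mulf_eq0 (negbTE (piX_neq0 n)) (negbTE b0).
move=> [/lattice_oddE[x0 x1]]; rewrite subrK lattice_evenE => x01.
have /not_vball[x10 vx] : ~ vball v (n + 1) (x 1 0) by move=> x1'; apply: x01.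
have vxn : v (x 1 0) = n by case: x1 => [/eqP|]; [rewrite (negbTE x10)|lia].
exists (pi ^ (- n) * x 0 0).
  by rewrite /ring_of_integers -(addNr n); exact: vball_piX.
exists (pi ^ (- n) * x 1 0); last by rewrite !piXK cv2K.
split; first by rewrite mulf_neq0// piX_neq0.
by rewrite (valM hF) ?piX_neq0// val_piX vxn addNr.
Qed.

End Orbits.

(** * Counting the cosets u I in I w I that carry a given layer to x *)

(** The coefficient of the indicator of layer K + j in T_w applied to the
    indicator of layer K, for w of length n. If the last letter s of w sends
    layer K outwards, T_s e_K = e_(K-1), then so do the other letters in turn
    and T_w e_K = e_(K-n): this is cnt_out. In the other case
    T_s e_K = q e_(K+1) + (q-1) e_K, and each further letter moves the first
    term inwards and splits off a summand, which then moves outwards: this is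
    cnt_in. *)
Definition cnt_in (q n : nat) (j : int) : nat :=
  if j == n%:Z then (q ^ n)%N
  else if (absz j < n)%N && odd (absz j + n) then (q.-1 * q ^ (absz (n%:Z - 1 + j)%R)./2)%N
  else 0%N.

Definition cnt_out (n : nat) (j : int) : nat := j == - n%:Z.

Definition cnt (b : bool) (q n : nat) (j : int) : nat :=
  if b then cnt_in q n j else cnt_out n j.

Lemma cnt_down b q n (j : int) : odd (absz j) = odd n (+) b ->
  cnt b q n.+1 j = (q * cnt b q n (j - 1))%N.
Proof.
case: b => jn; rewrite /cnt /cnt_in /cnt_out /=; last by case: eqP; case: eqP; lia.
have [->|jn1] := eqVneq j n.+1%:Z; first by rewrite ifT ?expnS//; lia.
by do 3 ?[rewrite ifF; last by lia]; rewrite muln0.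
Qed.

Lemma cnt_up b q n (j : int) : (0 < q)%N -> odd (absz j) = odd n (+) ~~ b ->
  cnt b q n.+1 j = (cnt b q n (j + 1) + q.-1 * cnt b q n j)%N.
Proof.
case: b => q0 jn; rewrite /cnt /cnt_in /cnt_out /=; last by case: eqP; case: eqP; case: eqP; lia.
rewrite ifF; last by lia.
rewrite [in X in (_ = X + _)%N]ifF; last by lia.
have [->|jn1] := eqVneq j n%:Z.
  rewrite ifT; last by lia.
  rewrite ifF; last by lia.
  by rewrite add0n; congr (_ * _ ^ _)%N; lia.
rewrite [in X in (_ = _ + q.-1 * X)%N]ifF; last by lia.
rewrite muln0 addn0; case: ifP => h; last by rewrite ifF//; lia.
by rewrite ifT; [congr (_ * _ ^ _)%N; lia|lia].
Qed.

(** * The measure of the part of I w I that carries a given layer to x *)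

Lemma oddB_absz (k K : int) : odd (absz (k - K)%R) = odd (absz k) (+) odd (absz K).
Proof. lia. Qed.

Lemma odd_absz_even (n : int) (s : bool) : odd (absz (2 * n + (s : nat)%:Z)%R) = s.
Proof. by case: s; lia. Qed.

Lemma odd_absz_odd (n : int) (s : bool) : odd (absz (2 * n + (s : nat)%:Z - 1)%R) = ~~ s.
Proof. by case: s; lia. Qed.

Section Fibres.
Variables (F : fieldType) (v : F -> int).
Hypothesis hF : is_local_field v.
Variable pi : F.
Hypothesis hpi : is_uniformizer v pi.

Notation G := (SL2 F).
Notation I := (iwahori v).

Lemma vball_bound (A : 'M[F]_2) : exists N : nat, forall i j, vball v (- N%:Z) (A i j).
Proof.
exists (\max_(i < 2) \max_(j < 2) absz (v (A i j)))%N => i j; right.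
have := leq_trans (leq_bigmax (F := fun j => absz (v (A i j))) j)
  (leq_bigmax (F := fun i => \max_(j < 2) absz (v (A i j)))%N i).
by move: (\max_(i < 2) _)%N => N; lia.
Qed.

(** I contains a neighbourhood of the identity. *)
Lemma right_invariant_open (A : set G) :
  (forall g k, A g -> I k -> A (g * k)%g) -> SL2_open v A.
Proof.
move=> Ainv g Ag; have [N gN] := vball_bound ((g^-1)%g : 'M[F]_2).
exists (N%:Z + 1) => h hg; rewrite -(mulVKg g h); apply: Ainv => //.
pose B : 'M[F]_2 := \matrix_(i, j) (h i j - g i j).
have kE : ((g^-1 * h)%g : 'M[F]_2) = 1%:M + ((g^-1)%g : 'M[F]_2) *m B.
  have -> : B = (h : 'M[F]_2) - (g : 'M[F]_2) by apply/matrixP => i j; rewrite !mxE.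
  by rewrite mulmxBr -!SL2_mulE mulVg SL2_oneE addrC subrK.
have gB i j : vball v 1 ((((g^-1)%g : 'M[F]_2) *m B) i j).
  rewrite mul2E -[1](addKr N%:Z) ; apply: vballD => //.
    by apply: vballM => //; rewrite mxE; exact: hg.
  by apply: vballM => //; rewrite mxE; exact: hg.
have v01 : vball v 0 1 by right; rewrite (val1 hF).
split=> [i j|]; rewrite kE mxE [X in X + _]mxE; last by rewrite add0r.
apply: vballD => //; last by apply: vballW (gB i j).
by case: eqP => _ //; exact: vball0.
Qed.

(** Its volume is the value at x of T_w applied to the indicator of layer K. *)
Definition fibre (K : int) (x : 'cV[F]_2) (w : affW) : set G :=
  [set u | double_coset v pi w u /\ layer v K (((u^-1)%g : 'M[F]_2) *m x)].

Lemma fibre_right_invariant K x w g k : fibre K x w g -> I k -> fibre K x w (g * k)%g.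
Proof.
move=> [dg lg] Ik; split; first exact: double_coset_mulr.
by rewrite invgM SL2_mulE -mulmxA layer_iwahori//; exact: iwahoriV.
Qed.

Lemma measurable_right_invariant (A : set (borelSL2 v)) :
  (forall g k : G, A g -> I k -> A (g * k)%g) -> measurable A.
Proof. by move=> Ainv; apply: sub_sigma_algebra; exact: right_invariant_open. Qed.

Lemma measurable_fibre K x w : measurable (fibre K x w : set (borelSL2 v)).
Proof. apply: measurable_right_invariant => g k; exact: fibre_right_invariant. Qed.

Variables (R : realType) (q : nat).
Hypothesis hq : (residue_classes v #= `I_q)%card.
Variable mu : {measure set (borelSL2 v) -> \bar R}.
Hypothesis hmu : is_haar mu.

(** Decomposing I s w I into the translates of I w I and using the invariance of
    the measure expresses the measure for s w at x through the measures for w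
    at the vectors to which the representatives pull x back. *)
Lemma measure_fibre n s x k K : layer v k x ->
  mu (fibre K x (alt s n)) =
  ((cnt (s (+) odd n == odd (absz K)) q n (k - K))%:R)%:E.
Proof.
have [rep [rep_int rep_ex rep_inj]] := residue_reps hF hq.
have q_gt1 := residue_card_gt1 hF hq.
elim: n s x k => [|n IHn] s x k kx.
  have -> : cnt (s (+) odd 0 == odd (absz K)) q 0 (k - K) = (k == K) :> nat.
    rewrite /cnt /cnt_in /cnt_out -[- 0%:Z]/(0%:Z) subr_eq0.
    by case: ifP => _; case: eqP.
  have [kK|kK] := eqVneq k K.
    rewrite -[RHS]/1%E; have [<- _] := hmu; congr (mu _); apply/seteqP; split=> u.
      by case; rewrite alt0 => /(double_coset_one hF hpi) Iu _.
    move=> Iu; split; first by rewrite alt0; exact/double_coset_one.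
    by rewrite layer_iwahori// -?kK//; exact: iwahoriV.
  rewrite -[RHS]/0%E -(measure0 mu); congr (mu _); apply/seteqP; split=> u // [+ ux].
  rewrite alt0 => /(double_coset_one hF hpi) Iu; move/eqP: kK; apply.
  by apply: layer_unique kx _; move: ux; rewrite layer_iwahori//; exact: iwahoriV.
pose y m := coset_pull hpi rep s m x.
pose c m := coset_rep hpi rep s m.
pose A m : set (borelSL2 v) := fibre K (y m) (alt (~~ s) n).
have AE : (fibre K x (alt s n.+1) : set (borelSL2 v)) =
    \bigcup_(m in `I_q) [set (c m * u)%g | u in (A m : set G)].
  apply/seteqP; split=> u.
    move=> [/(double_coset_cons hF hpi rep_int rep_ex)[m mq du] ux].
    exists m => //; exists ((c m)^-1 * u)%g; last by rewrite mulVKg.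
    split=> //; rewrite invgM invgK SL2_mulE /y /coset_pull -mulmxA (mulmxA (c m : 'M[F]_2)).
    by rewrite -SL2_mulE mulgV SL2_oneE mul1mx.
  move=> [m mq [u' [du' ux'] <-]]; split.
    by apply/(double_coset_cons hF hpi rep_int rep_ex); exists m; rewrite ?mulKg.
  by rewrite invgM SL2_mulE -mulmxA.
have mA m : measurable (A m) by exact: measurable_fibre.
have mcA m : measurable ([set (c m * u)%g | u in (A m : set G)] : set (borelSL2 v)).
  apply: measurable_right_invariant => g k' [u Au <-] Ik'.
  by exists (u * k')%g; rewrite ?mulgA//; exact: fibre_right_invariant.
rewrite AE measure_fin_bigcup//; last first.
  move=> m m' mq mq' [u [[u1 [d1 _] u1E] [u2 [d2 _] u2E]]].
  apply: (coset_rep_inj (hpi := hpi) hF rep_int rep_ex rep_inj (s := s) (n := n) (g := u)) => //.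
    by rewrite -u1E mulKg.
  by rewrite -u2E mulKg.
have muA m : mu [set (c m * u)%g | u in (A m : set G)] = mu (A m).
  by case: hmu => _; apply.
rewrite -fsbig_ord (eq_bigr (fun m : 'I_q => mu (A m))) => [|m _]; last exact: muA.
have bE : ~~ s (+) odd n = s (+) odd n.+1 by rewrite /= addNb addbN.
(* Whether the count is cnt_in or cnt_out depends on the last letter, hence is
   the same for the word without its first letter. *)
set b := s (+) odd n.+1 == _.
have [n' [k_even|k_odd]] : exists n' : int,
    k = 2 * n' + (s : nat)%:Z \/ k = 2 * n' + (s : nat)%:Z - 1.
  exists (((k - (s : nat)%:Z + 1) %/ 2)%Z); lia.
- rewrite (eq_bigr (fun=> ((cnt b q n (k - 1 - K))%:R)%:E)) => [|m _].
    rewrite sumEFin sumr_const card_ord -mulrnA mulnC; congr (_%:R)%:E.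
    rewrite cnt_down; last first.
      rewrite oddB_absz k_even odd_absz_even /b /=.
      by case: (s); case: (odd n); case: (odd (absz K)).
    by congr (_ * cnt _ _ _ _)%N; lia.
  rewrite (IHn (~~ s) _ (k - 1)) ?bE//.
  by rewrite k_even; apply: (@layer_down _ _ hF _ hpi rep q rep_int) => //; rewrite -?k_even.
have [|m0 m0q lm] := layer_up hF hpi rep_int rep_ex rep_inj (s := s) (n := n') (x := x).
  by rewrite -k_odd.
rewrite (bigD1 (Ordinal m0q))//= (IHn _ _ (k + 1)) ?bE; last first.
  by have := lm _ m0q; rewrite eqxx k_odd subrK.
rewrite (eq_bigr (fun=> ((cnt b q n (k - K))%:R)%:E)) => [|m mm0]; last first.
  rewrite (IHn _ _ k) ?bE//; have := lm _ (ltn_ord m).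
  by rewrite ifF -?k_odd//; apply/eqP => mE; case/eqP: mm0; exact: val_inj.
rewrite sumEFin sumr_const cardC1 card_ord -EFinD -mulrnA -natrD; congr (_%:R)%:E.
rewrite cnt_up//; [|exact: ltnW|]; last first.
  rewrite oddB_absz k_odd odd_absz_odd /b /=.
  by case: (s); case: (odd n); case: (odd (absz K)).
by rewrite mulnC; congr (cnt _ _ _ _ + _)%N; lia.
Qed.

End Fibres.

(** * The alternating series of the counts *)

Definition cnt_len (q n : nat) (j : int) : nat :=
  if n is 0 then (j == 0 : nat) else (cnt true q n j + cnt false q n j)%N.

Section Series.
Variables (R : realType) (q : nat).
Hypothesis q_gt1 : (1 < q)%N.
Let r : R := q%:R^-1.

(** Beyond n = |j| the weighted count is the decrease from n to n + 1 of a
    sequence of powers of q^(-1) that is constant on pairs of consecutive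
    integers. *)
Lemma cnt_len_weighted n (j : int) : r ^+ n * (cnt_len q n j)%:R =
  if (n < absz j)%N then 0
  else if n == absz j then r ^+ (absz (n.+1%:Z - j)%R)./2
  else r ^+ (absz (n%:Z - j)%R)./2 - r ^+ (absz (n.+1%:Z - j)%R)./2.
Proof.
have q0 : q%:R != 0 :> R by rewrite pnatr_eq0; lia.
have rq i : r ^+ i * (q ^ i)%:R = 1.
  by rewrite natrX -exprMn /r mulVf// expr1n.
case: ltnP => [nj|jn].
  case: n nj => [|n] nj; rewrite /cnt_len /cnt /cnt_in /cnt_out.
    by rewrite (_ : (j == 0) = false) ?mulr0//; lia.
  rewrite ifF; last by lia.
  rewrite ifF; last by lia.
  by rewrite (_ : (j == - _) = false) ?mulr0//; lia.
case: n jn => [|n] jn.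
  have -> : j = 0 by lia.
  by rewrite /cnt_len /= !expr0 mulr1.
rewrite /cnt_len /cnt /cnt_in /cnt_out; case: (n.+1 =P absz j) => nj.
  have [->|jn1] := eqVneq j n.+1%:Z.
    rewrite (_ : (_ == - _) = false); last by lia.
    by rewrite addn0 rq (_ : _./2 = 0%N) ?expr0//; lia.
  rewrite ifF; last by lia.
  have -> : j == - n.+1%:Z by lia.
  by rewrite mulr1; congr (r ^+ _); lia.
rewrite ifF; last by lia.
rewrite (_ : (j == - _) = false) ?addn0; last by lia.
case: ifP => h; last first.
  by rewrite mulr0 (_ : _./2 = (absz (n.+2%:Z - j)%R)./2) ?subrr//; lia.
pose i := (absz (n.+1%:Z - j)%R)./2; rewrite -/i.
rewrite (_ : _./2 = (n - i)%N); last by rewrite /i; lia.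
rewrite (_ : (absz (n.+2%:Z - j)%R)./2 = i.+1); last by rewrite /i; lia.
have ni : (i <= n)%N by rewrite /i; lia.
rewrite (_ : n.+1 = (i.+1 + (n - i))%N); last by lia.
rewrite exprD natrM mulrACA rq mulr1 exprS -subn1 natrB; last by lia.
have rq1 : r * q%:R = 1 by exact: mulVf.
by rewrite mulrBr mulr1 mulrAC rq1 mul1r.
Qed.

(** The alternating series of the counts telescopes: past the first nonzero
    term each partial sum is, up to sign, a power of q^(-1). *)
Lemma cnt_len_series N (j : int) : \sum_(0 <= n < N) (- r) ^+ n * (cnt_len q n j)%:R =
  if (absz j < N)%N then (-1) ^+ absz j * r ^+ (absz (N%:Z - j)%R)./2 else 0.
Proof.
elim: N => [|N IHN]; first by rewrite big_nil.
rewrite big_nat_recr//= IHN [(- r) ^+ N]exprNn -(mulrA ((-1) ^+ N)) cnt_len_weighted ltnS.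
case: (ltngtP (absz j) N) => jN.
- rewrite mulrBr addrA addrAC.
  have [oj|ej] := boolP (odd (absz j + N)).
    have -> : (-1) ^+ N = - (-1) ^+ absz j :> R.
      rewrite -(signr_odd _ N) -(signr_odd _ (absz j)); move: oj; rewrite oddD.
      by case: odd; case: odd => // _; rewrite ?expr0 ?expr1 ?opprK.
    by ring.
  have -> : (absz (N.+1%:Z - j)%R)./2 = (absz (N%:Z - j)%R)./2 by lia.
  by ring.
- by rewrite mulr0 addr0.
- by rewrite add0r jN.
Qed.

Lemma cnt_len_abs_series N (j : int) : \sum_(0 <= n < N) r ^+ n * (cnt_len q n j)%:R =
  if (absz j < N)%N then
    2 * r ^+ (absz ((absz j).+1%:Z - j)%R)./2 - r ^+ (absz (N%:Z - j)%R)./2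
  else 0.
Proof.
elim: N => [|N IHN]; first by rewrite big_nil.
rewrite big_nat_recr//= IHN cnt_len_weighted ltnS.
case: (ltngtP (absz j) N) => jN.
- by ring.
- by rewrite addr0.
- by rewrite add0r -jN; ring.
Qed.

Lemma r_ge0 : 0 <= r. Proof. by rewrite invr_ge0. Qed.

Lemma r_lt1 : r < 1.
Proof. by rewrite invf_lt1 ?ltr1n// ltr0n; lia. Qed.

Lemma cnt_len_abs_series_le N j :
  \sum_(0 <= n < N) r ^+ n * (cnt_len q n j)%:R <= 2.
Proof.
rewrite cnt_len_abs_series; case: ifP => // _.
have r1 i : r ^+ i <= 1 by rewrite exprn_ile1// ?r_ge0// ltW// r_lt1.
have r0 i : 0 <= r ^+ i by rewrite exprn_ge0// r_ge0.
have := r1 (absz ((absz j).+1%:Z - j)%R)./2; have := r0 (absz (N%:Z - j)%R)./2.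
lra.
Qed.

Lemma cnt_len_series_cvg (j : int) :
  (fun N => \sum_(0 <= n < N) (- r) ^+ n * (cnt_len q n j)%:R) @ \oo --> (0 : R).
Proof.
apply/cvgrPdist_lt => e e0.
have : (fun n => r ^+ n) @ \oo --> (0 : R).
  by apply: cvg_expr; rewrite ger0_norm ?r_ge0// r_lt1.
move=> /cvgrPdist_lt/(_ e e0)[M _ HM].
(* Large enough for the exponent in cnt_len_series to exceed M. *)
exists (2 * M + absz j + 2)%N => // N /= NM; rewrite cnt_len_series.
case: ifP => _; last by rewrite subrr normr0.
rewrite sub0r normrN normrM normrX normrN1 expr1n mul1r.
by have := HM (absz (N%:Z - j)%R)./2; rewrite /= sub0r normrN; apply; lia.
Qed.

End Series.

(** * The convolution *)

Section Convolution.
Variables (R : realType) (H : algType lpoly) (T : affW -> H).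
Hypothesis hT : is_hecke T.
Variables (F : fieldType) (v : F -> int).
Hypothesis hF : is_local_field v.
Variable pi : F.
Hypothesis hpi : is_uniformizer v pi.
Variable q : nat.
Hypothesis hq : (residue_classes v #= `I_q)%card.
Variable mu : {measure set (borelSL2 v) -> \bar R}.
Hypothesis hmu : is_haar mu.

Notation G := (SL2 F).
Notation I := (iwahori v).

Let q_gt1 : (1 < q)%N := residue_card_gt1 hF hq.
Let r : R := q%:R^-1.
Let a : R := (1 - r) / (1 + r).

Lemma t_funE w g : double_coset v pi w g -> t_fun v R pi T q 1%g g = a * (- r) ^+ ell w.
Proof.
move=> dg; rewrite /t_fun (@fsum_on _ _ _ [:: w])// => [|w'].
  by rewrite big_seq1 rat_value_bcoef ?(ltnW q_gt1)// indicE mem_set// mulr1.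
rewrite inE => ww'; rewrite indicE memNset ?mulr0// => dg'.
by rewrite (double_coset_inj hF hpi dg dg') eqxx in ww'.
Qed.

Lemma t_fun_mulr g k : I k -> t_fun v R pi T q 1%g (g * k)%g = t_fun v R pi T q 1%g g.
Proof.
move=> Ik; rewrite /t_fun; apply: eq_fsbigr => w _; congr (_ * _).
rewrite !indicE; congr ((nat_of_bool _)%:R); apply/idP/idP; rewrite !inE; last first.
  exact: double_coset_mulr.
move=> /(double_coset_mulr hF hpi (iwahoriV hF Ik)); by rewrite mulgK.
Qed.

Variables (k K : int) (x : 'cV[F]_2).
Hypothesis kx : layer v k x.

Let f := conv_integrand (t_fun v R pi T q 1%g) \1_(layer v K) x : borelSL2 v -> \bar R.

Let j := k - K.

(** The two sets are disjoint for n > 0 and coincide for n = 0. *)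
Let fib (n : nat) : set (borelSL2 v) :=
  fibre v pi K x (alt false n) `|` fibre v pi K x (alt true n).

Let measurable_fib n : measurable (fib n).
Proof. by apply: measurableU; exact: measurable_fibre. Qed.

Let fib_layer n (u : G) : fib n u -> layer v K (((u^-1)%g : 'M[F]_2) *m x).
Proof. by case=> -[]. Qed.

Let fib_coset n (u : G) : fib n u -> exists b, double_coset v pi (alt b n) u.
Proof. by case=> -[]; [exists false|exists true]. Qed.

Lemma trivIset_fib : trivIset setT fib.
Proof.
move=> n n' _ _ [u [/fib_coset[b d] /fib_coset[b' d']]].
by have [] := alt_inj (double_coset_inj hF hpi d d').
Qed.

Lemma measure_fib n : mu (fib n) = ((cnt_len q n j)%:R)%:E.
Proof.
case: n => [|n].
  rewrite /fib !alt0 setUid -(alt0 false) (measure_fibre hF hpi hq hmu _ _ _ kx).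
  congr (_%:R)%:E; rewrite /cnt /cnt_in /cnt_out -[- 0%:Z]/(0%:Z) -/j.
  by case: ifP => _ /=; case: (j == 0).
transitivity (mu (fibre v pi K x (alt false n.+1)) + mu (fibre v pi K x (alt true n.+1)))%E.
  apply: measureU; try exact: measurable_fibre.
  apply/seteqP; split=> u // [[d _] [d' _]].
  by have [_ /(_ isT)] := alt_inj (double_coset_inj hF hpi d d').
rewrite !(measure_fibre hF hpi hq hmu _ _ _ kx) -EFinD -natrD -/j; congr (_%:R)%:E.
rewrite /cnt_len -!(addbC (odd _)) addbT addbF.
by case: (odd n.+1); case: (odd (absz K)); rewrite /= // addnC.
Qed.

Lemma conv_integrandE n u : fib n u -> f u = (a * (- r) ^+ n)%:E.
Proof.
move=> fu; have [b d] := fib_coset fu.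
rewrite /f /conv_integrand (t_funE d) ell_alt indicE mem_set ?mulr1//.
exact: fib_layer fu.
Qed.

Lemma conv_integrand_out u : ~ (\bigcup_n fib n) u -> f u = 0%E.
Proof.
move=> fu; rewrite /f /conv_integrand indicE.
have [lu|lu] := pselect (layer v K (((u : G)^-1%g : 'M[F]_2) *m x)); last first.
  by rewrite memNset// mulr0.
rewrite /t_fun fsbig1 ?mul0r// => w _.
rewrite indicE memNset ?mulr0// => dw; apply: fu; exists (ell w) => //.
have [b wE] := alt_ex w; rewrite wE in dw; case: b {wE} dw => dw; [right|left]; split=> //;
  by move: dw; rewrite ell_alt.
Qed.

Lemma measurable_conv_integrand : measurable_fun setT f.
Proof.
move=> _ Y _; rewrite setTI; apply: measurable_right_invariant => // g h Yg Ih.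
suff fE : f (g * h)%g = f g by rewrite -[_ _]/(Y (f (g * h)%g)) fE.
rewrite /f /conv_integrand t_fun_mulr// invgM SL2_mulE -mulmxA !indicE.
congr (_ * (nat_of_bool _)%:R)%:E; apply/idP/idP; rewrite !inE => lg.
  by rewrite layer_iwahori// in lg; exact: iwahoriV.
by rewrite layer_iwahori//; exact: iwahoriV.
Qed.

Lemma integral_restrict (g : borelSL2 v -> \bar R) :
  (forall u, ~ (\bigcup_n fib n) u -> g u = 0%E) ->
  (\int[mu]_u g u = \int[mu]_(u in \bigcup_n fib n) g u)%E.
Proof.
move=> g0; rewrite [RHS]integral_mkcond; apply: eq_integral => u _.
by rewrite patchE; case: ifPn => //; rewrite notin_setE => /g0.
Qed.

Lemma conv_integrable : mu.-integrable setT f.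
Proof.
apply/integrableP; split; first exact: measurable_conv_integrand.
rewrite integral_restrict => [|u /conv_integrand_out->]; last by rewrite abse0.
rewrite ge0_integral_bigcup//; last 2 first.
- apply: measurableT_comp => //.
  apply: measurable_funS measurable_conv_integrand => //.
- exact: trivIset_fib.
have fE n : (\int[mu]_(u in fib n) `|f u|)%E =
    (`|a| * (r ^+ n * (cnt_len q n j)%:R))%:E.
  rewrite (eq_integral (cst (`|a| * r ^+ n)%:E)) => [|u].
    by rewrite integral_cst// [X in (_ * X)%E]measure_fib -EFinM mulrA.
  rewrite inE => /conv_integrandE->.
  by rewrite abse_EFin normrM normrX normrN (ger0_norm (r_ge0 _ _)).
rewrite (eq_eseriesr (fun n _ => fE n)).
apply: (@le_lt_trans _ _ (`|a| * 2)%:E); last exact: ltry.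
apply: lime_le.
  apply: is_cvg_nneseries => n _ _; rewrite lee_fin.
  by rewrite !mulr_ge0// exprn_ge0// r_ge0.
apply: nearW => N; rewrite sumEFin lee_fin -mulr_sumr.
by rewrite ler_wpM2l// cnt_len_abs_series_le.
Qed.

Lemma conv_integral : (\int[mu]_u f u = 0)%E.
Proof.
rewrite integral_restrict; last exact: conv_integrand_out.
rewrite integral_bigcup//; last 2 first.
- exact: trivIset_fib.
- by apply: integrableS conv_integrable => //; exact: bigcup_measurable.
have fE n : (\int[mu]_(u in fib n) f u)%E =
    (a * ((- r) ^+ n * (cnt_len q n j)%:R))%:E.
  rewrite (eq_integral (cst (a * (- r) ^+ n)%:E)) => [|u].
    by rewrite integral_cst// [X in (_ * X)%E]measure_fib -EFinM mulrA.
  by rewrite inE => /conv_integrandE->.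
rewrite (eq_eseriesr (fun n _ => fE n)).
apply: cvg_lim => //.
under eq_cvg do rewrite sumEFin -mulr_sumr.
apply: cvg_EFin; first by apply: nearW.
rewrite -[X in _ --> X](mulr0 a); apply: cvgMr.
exact: cnt_len_series_cvg.
Qed.

End Convolution.

Theorem proposition4 (R : realType)
  (H : algType lpoly) (T : affW -> H) (hT : is_hecke T)
  (F : fieldType) (v : F -> int) (hF : is_local_field v)
  (pi : F) (hpi : is_uniformizer v pi)
  (q : nat) (hq : (residue_classes v #= `I_q)%card)
  (mu : {measure set (borelSL2 v) -> \bar R}) (hmu : is_haar mu)
  (m : int) (x : 'cV[F]_2) (hx : x != 0) :
  conv_at mu (t_fun v R pi T q 1%g) (psi v R pi m) x 0 /\
  conv_at mu (t_fun v R pi T q 1%g) (varphi v R pi m) x 0.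
Proof.
have [k kx] := layer_ex v hx.
rewrite (psiE hF hpi) (varphiE hF hpi).
by split; split; by [exact: conv_integrable kx|exact: conv_integral kx].
Qed.
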